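(* Let $(X, d)$ be a complete metric space and $\mu$ a Borel measure on $X$. Let $1<p \leq Q<\infty$ and $m\geq 0$. Suppose that $$\mu(B(x,r))\leq Cr^Q$$ for all $x\in X$ and all $r>0$, where $C>0$ is some fixed number. If $A\subset X$ is a compact set with $\mathcal H^{Q-p}(A)<\infty$ and if $\Lambda\subset\mathbf I_m^0(X)$ is a family with $\operatorname{spt} T \subset A$ for every $T\in\Lambda$, then $$\operatorname{cap}_p(\Lambda, \mathbf I_{m+1}(X))=0.$$
   Context: $B(x,r)$ is the closed ball; $\mathcal H^\alpha$ is the $\alpha$-dimensional Hausdorff measure. Metric currents. $\operatorname{Lip}(X)$, $\operatorname{Lip}_b(X)$ are the spaces of real-valued Lipschitz, resp. bounded Lipschitz functions on $X$; $\operatorname{Lip}(f)$ is the Lipschitz constant. For $m\ge 0$, an $m$-dimensional metric current on $X$ (in the sense of Ambrosio–Kirchheim) is a multilinear functional $T:\operatorname{Lip}_b(X)\times\operatorname{Lip}(X)^m\to\mathbb R$ such that: (1) $T(f,\pi_1^j,\dots,\pi_m^j)\to T(f,\pi_1,\dots,\pi_m)$ whenever $\pi_i^j\to\pi_i$ pointwise as $j\to\infty$ and $\sup_{i,j}\operatorname{Lip}(\pi_i^j)<\infty$; (2) $T(f,\pi_1,\dots,\pi_m)=0$ whenever $\{f\neq 0\}\subset\bigcup_{i=1}^m B_i$ with $B_i$ Borel and $\pi_i$ constant on $B_i$; (3) there is a finite Borel measure $\nu$ on $X$ with $|T(f,\pi_1,\dots,\pi_m)|\le \prod_{i=1}^m\operatorname{Lip}(\pi_i)\int_X|f|\,d\nu$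 for all $(f,\pi_1,\dots,\pi_m)$. The space of these is $\mathbf M_m(X)$; the minimal $\nu$ in (3) is denoted $\|T\|$, and $\operatorname{spt}T=\{x:\|T\|(B(x,r))>0\ \forall r>0\}$. $T$ extends to tuples whose first argument is a bounded Borel function; for Borel $U$, $(T\llcorner U)(f,\pi)=T(f1_U,\pi)$. For $m\ge1$ the boundary is $\partial T(f,\pi_1,\dots,\pi_{m-1})=T(1,f,\pi_1,\dots,\pi_{m-1})$; $T$ is normal if $\partial T\in\mathbf M_{m-1}(X)$; all elements of $\mathbf M_0(X)$ are called normal. The push-forward under a Lipschitz map $\varphi:X\to Y$ into a complete metric space is $\varphi_\#T(g,\tau)=T(g\circ\varphi,\tau\circ\varphi)$. For $\theta\in L^1(\mathbb R^m)$ let $[\![\theta]\!](f,\pi)=\int_{\mathbb R^m}\theta f\det(\nabla\pi)\,d\mathcal H^m$. $T\in\mathbf M_0(X)$ is integer rectifiable if $T(f)=\sum_{i=1}^k\theta_if(x_i)$ for finitely many $x_i\in X$, $\theta_i\in\mathbb Z\setminus\{0\}$ (including $T=0$); $T\in\mathbf M_m(X)$, $m\ge1$, is integer rectifiable if $\|T\|$ is concentrated on a countably $\mathcal H^m$-rectifiable set and vanishes on $\mathcal H^m$-negligible Borel sets, and for every Lipschitz $\varphi:X\to\mathbb R^m$ and every open $U\subset X$ there is $\theta\in L^1(\mathbb R^m,\mathbb Z)$ with $\varphi_\#(T\llcorner U)=[\![\theta]\!]$. $\mathbf I_m(X)$ (integral currents) is the set of integer rectifiable normal $m$-currents, and $\mathbf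 I_m^0(X)$ is the set of $T\in\mathbf I_m(X)$ with $\partial T=0$ (for $m\ge 1$) or $T(1)=0$ (for $m=0$). Modulus and capacity. For $\Gamma\subset\mathbf M_k(X)$ and $1\le p<\infty$, $M_p(\Gamma)=\inf\int_X f^p\,d\mu$, the infimum over all Borel $f\ge0$ on $X$ with $\int_X f\,d\|S\|\ge1$ for every $S\in\Gamma$. For a family $\Lambda$ of $m$-currents $T$ in $\mathbf M_m(X)$ without boundary ($\partial T=0$ if $m\ge1$, $T(1)=0$ if $m=0$) and $\mathcal C'\subset\mathbf M_{m+1}(X)$, $\operatorname{cap}_p(\Lambda,\mathcal C')=M_p(\{S\in\mathcal C':\partial S=T\text{ for some }T\in\Lambda\})$.
   Formalization: Every T in Λ is assumed nonzero: if the zero current lies in Λ, then S = 0 is a filling with zero mass measure, no f is admissible, and the capacity is +∞, so the printed claim fails exactly for such Λ. *)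

(* Defs.v *)
From HB Require Import structures.
From mathcomp Require Import all_boot all_order all_algebra.
From mathcomp Require Import all_classical all_reals all_analysis.
From mathcomp Require Import measurable_realfun.
From mathcomp Require Import ring lra.

Set Implicit Arguments.
Unset Strict Implicit.
Unset Printing Implicit Defensive.
Import Order.TTheory GRing.Theory Num.Theory.
Import numFieldNormedType.Exports.
Local Open Scope classical_set_scope.
Local Open Scope ring_scope.

(* Nonemptiness ([isPointed]) is required by the library's [completeType] and
   [measurableType]. *)
#[short(type="pmetricType")]
HB.structure Definition PointedMetric (K : numDomainType) :=
  {T of Metric K T & PseudoPointedMetric K T}.

#[short(type="completeMetricType")]
HB.structure Definition CompleteMetric (K : numDomainType) :=
  {T of Metric K T & CompletePseudoMetric K T}.

Definition borel (X : ptopologicalType) := g_sigma_algebraType (@open X).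

(* B(x, r). The library's [closed_ball] is the closure of the open ball, which
   may be smaller. *)
Definition cball (R : realType) (X : metricType R) (x : X) (r : R) : set X :=
  [set y | mdist x y <= r].

(* R^m with its Euclidean distance; the library's norm on ['rV[R]_m] is the
   sup norm. *)
Section euclidean.
Variables (R : realType) (m : nat).

Definition eucl := 'rV[R]_m.

Definition eucl_dist (x y : eucl) : R :=
  Num.sqrt (\sum_(i < m) (x ord0 i - y ord0 i) ^+ 2).

Lemma eucl_distxx x : eucl_dist x x = 0.
Proof.
rewrite /eucl_dist big1 ?sqrtr0// => i _.
by rewrite subrr expr0n.
Qed.

Lemma eucl_dist_positivity x y : eucl_dist x y = 0 -> x = y.
Proof.
move=> /eqP; rewrite sqrtr_eq0 => h.
have h0 : \sum_(i < m) (x ord0 i - y ord0 i) ^+ 2 == 0.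
  by rewrite eq_le h /= sumr_ge0// => i _; rewrite sqr_ge0.
apply/rowP => i; move: h0; rewrite psumr_eq0; last first.
  by move=> j _; rewrite sqr_ge0.
move=> /allP/(_ i (mem_index_enum _)) /=.
by rewrite sqrf_eq0 subr_eq0 => /eqP.
Qed.

Lemma eucl_dist_sym x y : eucl_dist x y = eucl_dist y x.
Proof.
rewrite /eucl_dist; congr Num.sqrt; apply: eq_bigr => i _.
by rewrite -sqrrN opprB.
Qed.

Lemma sum_cauchy_schwarz (a b : 'I_m -> R) :
  (\sum_i a i * b i) ^+ 2 <= (\sum_i a i ^+ 2) * (\sum_i b i ^+ 2).
Proof.
set S := \sum_i a i * b i; set A := \sum_i a i ^+ 2; set B := \sum_i b i ^+ 2.
have A0 : 0 <= A by apply: sumr_ge0 => i _; rewrite sqr_ge0.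
have key : 0 <= A * (A * B - S ^+ 2).
  have -> : A * (A * B - S ^+ 2) = \sum_i (A * b i - S * a i) ^+ 2.
    under eq_bigr => i _.
      rewrite (_ : _ ^+ 2 =
        A ^+ 2 * b i ^+ 2 + (- (2 * A * S)) * (a i * b i) +
        S ^+ 2 * a i ^+ 2); last first.
        by rewrite sqrrB !exprMn mulr2n; lra.
      over.
    rewrite !big_split /= -!mulr_sumr -/S -/A -/B; lra.
  by apply: sumr_ge0 => i _; rewrite sqr_ge0.
move: A0; rewrite le_eqVlt => /orP[/eqP A0|A0]; last first.
  by rewrite -subr_ge0 -(pmulr_rge0 _ A0).
have a0 i : a i = 0.
  have : A == 0 by rewrite -A0.
  rewrite psumr_eq0; last by move=> j _; rewrite sqr_ge0.
  by move=> /allP/(_ i (mem_index_enum _)) /=; rewrite sqrf_eq0 => /eqP.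
have -> : S = 0 by rewrite /S big1// => i _; rewrite a0 mul0r.
by rewrite -A0 mul0r expr0n.
Qed.

Lemma eucl_dist_triangle y x z :
  eucl_dist x z <= eucl_dist x y + eucl_dist y z.
Proof.
pose a i := x ord0 i - y ord0 i; pose b i := y ord0 i - z ord0 i.
pose A := \sum_i a i ^+ 2; pose B := \sum_i b i ^+ 2.
pose S := \sum_i a i * b i.
have A0 : 0 <= A by apply: sumr_ge0 => i _; rewrite sqr_ge0.
have B0 : 0 <= B by apply: sumr_ge0 => i _; rewrite sqr_ge0.
have -> : eucl_dist x z = Num.sqrt (A + B + 2 * S).
  congr Num.sqrt; rewrite /A /B /S mulr_sumr -!big_split /=.
  by apply: eq_bigr => i _; rewrite /a /b; lra.
rewrite -[leRHS]ger0_norm ?addr_ge0 ?sqrtr_ge0// -sqrtr_sqr ler_wsqrtr//.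
rewrite sqrrD /eucl_dist !sqr_sqrtr// -/A -/B.
have : S <= Num.sqrt A * Num.sqrt B.
  rewrite -sqrtrM// (le_trans (ler_norm _))// -sqrtr_sqr ler_wsqrtr//.
  exact: sum_cauchy_schwarz.
rewrite mulr2n; lra.
Qed.

HB.instance Definition _ := Choice.on eucl.
HB.instance Definition _ := isMetric.Build R eucl
  eucl_distxx eucl_dist_positivity eucl_dist_sym eucl_dist_triangle.
HB.instance Definition _ := isPointed.Build eucl (0 : 'rV[R]_m).

End euclidean.

Section hausdorff.
Context {R : realType}.

Definition Gamma (s : R) : R :=
  (\int[lebesgue_measure]_(t in `]0%R, +oo[) (t `^ (s - 1) * expR (- t)))%R.

(* Volume of the Euclidean ball of diameter 1 in dimension a, so that H^m is
   Lebesgue measure on R^m. *)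
Definition hausdorff_const (a : R) : R :=
  pi `^ (a / 2) / Gamma (a / 2 + 1) / 2 `^ a.

Context {X : metricType R}.

(* -oo on the empty set *)
Definition diam (E : set X) : \bar R :=
  ereal_sup [set (mdist x y)%:E | x in E & y in E].

(* c_a diam(E)^a, with the conventions diam(set0)^a = 0 and 0^0 = 1 for
   nonempty E: H^0 is the counting measure. *)
Definition hausdorff_gauge (a : R) (E : set X) : \bar R :=
  if `[< E = set0 >] then 0%E else ((hausdorff_const a)%:E * diam E `^ a)%E.

Definition hausdorff_content (a d : R) (A : set X) : \bar R :=
  ereal_inf [set (\sum_(i <oo) hausdorff_gauge a (E i))%E | E in
    [set E : nat -> set X |
      A `<=` \bigcup_i E i /\ forall i, (diam (E i) <= d%:E)%E]].

Definition hausdorff (a : R) (A : set X) : \bar R :=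
  ereal_sup [set hausdorff_content a d A | d in [set d | 0 < d]].

End hausdorff.

Section lipschitz.
Context {R : realType}.

Definition lipschitz_with (X Y : metricType R) (f : X -> Y) (L : R) :=
  0 <= L /\ forall x y, mdist (f x) (f y) <= L * mdist x y.

Definition lipschitz_map (X Y : metricType R) (f : X -> Y) :=
  exists L, lipschitz_with f L.

Record lip (X : metricType R) := MkLip {
  lip_fun :> X -> R ;
  lip_prop : lipschitz_map (lip_fun : X -> R^o) }.

Record lipb (X : metricType R) := MkLipb {
  lipb_lip :> lip X ;
  lipb_prop : exists M, forall x, `|lipb_lip x| <= M }.

Definition Lip (X : metricType R) (f : lip X) : R :=
  inf [set L | lipschitz_with (lip_fun f : X -> R^o) L].

Lemma lipschitz_comp (X Y Z : metricType R) (f : X -> Y) (g : Y -> Z) :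
  lipschitz_map f -> lipschitz_map g -> lipschitz_map (g \o f).
Proof.
move=> [L [L0 fL]] [K [K0 gK]]; exists (K * L); split; first exact: mulr_ge0.
by move=> x y; rewrite (le_trans (gK _ _))// -mulrA ler_wpM2l.
Qed.

Definition lip_comp (X Y : metricType R) (f : X -> Y) (hf : lipschitz_map f)
    (g : lip Y) : lip X :=
  MkLip (@lipschitz_comp X Y R^o f (lip_fun g) hf (lip_prop g)).

Lemma bounded_comp (X Y : metricType R) (f : X -> Y) (hf : lipschitz_map f)
    (g : lipb Y) : exists M, forall x, `|lip_comp hf g x| <= M.
Proof. by have [M gM] := lipb_prop g; exists M => x; exact: gM. Qed.

Definition lipb_comp (X Y : metricType R) (f : X -> Y) (hf : lipschitz_map f)
    (g : lipb Y) : lipb X :=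
  MkLipb (bounded_comp hf g).

Lemma lipschitz_one (X : metricType R) :
  lipschitz_map ((fun=> 1) : X -> R^o).
Proof. by exists 0; split => // x y; rewrite mul0r /mdist/= subrr normr0. Qed.

Lemma bounded_one (X : metricType R) :
  exists M, forall x, `|MkLip (lipschitz_one X) x| <= M.
Proof. by exists 1 => x; rewrite normr1. Qed.

Definition lipb_one (X : metricType R) : lipb X := MkLipb (bounded_one X).

End lipschitz.

Definition functional (R : realType) (X : metricType R) (m : nat) :=
  lipb X -> ('I_m -> lip X) -> R.

Definition fcons (T : Type) (m : nat) (a : T) (s : 'I_m -> T) : 'I_m.+1 -> T :=
  fun i => if unlift ord0 i is Some j then s j else a.

Section currents.
Context {R : realType} {X : pmetricType R}.

Definition multilinear m (T : functional X m) :=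
  (forall (a : R) (f g h : lipb X) s,
     (forall x, h x = a * f x + g x) -> T h s = a * T f s + T g s) /\
  (forall (i : 'I_m) (a : R) (f : lipb X) (s t u : 'I_m -> lip X),
     (forall j, j != i -> t j = s j /\ u j = s j) ->
     (forall x, u i x = a * s i x + t i x) -> T f u = a * T f s + T f t).

Definition mass_bound m (T : functional X m)
    (nu : {finite_measure set (borel X) -> \bar R}) :=
  forall (f : lipb X) (s : 'I_m -> lip X),
    (`|T f s|%:E <= (\prod_i Lip (s i))%:E * \int[nu]_x `|f x|%:E)%E.

Definition is_current m (T : functional X m) :=
  [/\ multilinear T,
      (forall (f : lipb X) (s_ : nat -> 'I_m -> lip X) (s : 'I_m -> lip X),
         (forall i x, s_ j i x @[j --> \oo] --> s i x) ->
         (exists K, forall j i, Lip (s_ j i) <= K) ->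
         T f (s_ j) @[j --> \oo] --> T f s),
      (forall (f : lipb X) (s : 'I_m -> lip X) (B : 'I_m -> set (borel X)),
         (forall i, measurable (B i)) ->
         (forall i, exists c, forall x, B i x -> s i x = c) ->
         [set x | f x != 0] `<=` \bigcup_i B i -> T f s = 0) &
      exists nu, mass_bound T nu].

Definition is_mass m (T : functional X m)
    (nu : {finite_measure set (borel X) -> \bar R}) :=
  mass_bound T nu /\
  forall nu', mass_bound T nu' ->
    forall B, measurable B -> (nu B <= nu' B)%E.

(* ||T||: the least measure bounding T, which exists when T is a current. *)
Definition mass m (T : functional X m) : {measure set (borel X) -> \bar R} :=
  if pselect (exists nu, is_mass T nu) is left ex then sval (cid ex)
  else mzero.

Definition spt m (T : functional X m) : set X :=
  [set x | forall r, 0 < r -> (0 < mass T (cball x r))%E].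

(* Extension of T to a bounded Borel first argument, by L^1(||T||)-continuity
   from bounded Lipschitz functions, which are dense in L^1(||T||). *)
Definition borel_ext m (T : functional X m) (g : X -> R) (s : 'I_m -> lip X) :
    R :=
  xget 0 [set v | exists2 u : nat -> lipb X,
    ((\int[mass T]_x `|u n x - g x|%:E) @[n --> \oo] --> 0)%E &
    T (u n) s @[n --> \oo] --> v].

Definition restriction m (T : functional X m) (U : set X) : functional X m :=
  fun f s => borel_ext T (fun x => f x * \1_U x) s.

Definition boundary m (T : functional X m.+1) : functional X m :=
  fun f s => T (lipb_one X) (fcons (lipb_lip f) s).

Definition normal_current m : functional X m -> Prop :=
  match m with
  | 0 => fun T => is_current T
  | _.+1 => fun T => is_current T /\ is_current (boundary T)
  end.

Definition no_boundary m : functional X m -> Prop :=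
  match m with
  | 0 => fun T => forall s, T (lipb_one X) s = 0
  | _.+1 => fun T => forall f s, boundary T f s = 0
  end.

Definition pushforward (Y : metricType R) m (phi : X -> Y)
    (hphi : lipschitz_map phi) (T : functional X m) : functional Y m :=
  fun g t => T (lipb_comp hphi g) (fun i => lip_comp hphi (t i)).

Definition countably_rectifiable m (E : set X) :=
  exists (A : nat -> set (eucl R m)) (g : nat -> eucl R m -> X),
    (forall i, exists L, forall x y, A i x -> A i y ->
       mdist (g i x) (g i y) <= L * mdist x y) /\
    hausdorff m%:R (E `\` \bigcup_i (g i @` A i)) = 0%E.

End currents.

(* [[theta]](f, s) = int theta f det(grad s) dH^m. The integral is over the
   points of differentiability, a set of full measure by Rademacher; it is taken
   over the Borel sigma-algebra, on which the set function H^m is a measure. *)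
Definition jacobian_current (R : realType) m (theta : eucl R m -> R) :
    functional (eucl R m) m :=
  fun f s =>
    let F : 'rV[R]_m -> 'rV[R]_m := fun x => \row_i s i x in
    fine (integral (hausdorff m%:R : set (borel (eucl R m)) -> \bar R)
      [set x : 'rV[R]_m | differentiable F x]
      (fun x => (theta x * f x * \det ('J F x))%:E)).

Section integral_currents.
Context {R : realType} {X : pmetricType R}.

Definition integer_rectifiable m : functional X m -> Prop :=
  match m with
  | 0 => fun T =>
      is_current T /\
      exists (k : nat) (theta : 'I_k -> int) (a : 'I_k -> X),
        (forall i, theta i != 0) /\
        forall f s, T f s = \sum_i (theta i)%:~R * f (a i)
  | m'.+1 => fun T =>
      [/\ is_current T,
          (exists E : set X, countably_rectifiable m'.+1 E /\
             (mass T).-negligible (~` E)),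
          (forall B : set (borel X), measurable B ->
             hausdorff m'.+1%:R (B : set X) = 0%E -> mass T B = 0%E) &
          (forall (phi : X -> eucl R m'.+1) (hphi : lipschitz_map phi)
             (U : set X), open U ->
             exists theta : eucl R m'.+1 -> int,
               integrable
                 (hausdorff m'.+1%:R : set (borel (eucl R m'.+1)) -> \bar R)
                 setT (fun x => (theta x)%:~R%:E) /\
               pushforward hphi (restriction T U) =
                 jacobian_current (fun x => (theta x)%:~R))]
  end.

Definition integral_current m (T : functional X m) :=
  integer_rectifiable T /\ normal_current T.

Definition integral_cycle m (T : functional X m) :=
  integral_current T /\ no_boundary T.

Definition modulus k (p : R) (mu : {measure set (borel X) -> \bar R})
    (G : set (functional X k)) : \bar R :=
  ereal_inf [set (\int[mu]_x (f x `^ p))%E | f in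
    [set f : borel X -> \bar R |
      [/\ measurable_fun setT f, (forall x, (0 <= f x)%E) &
          forall S, G S -> (1 <= \int[mass S]_x f x)%E]]].

Definition capacity m (p : R) (mu : {measure set (borel X) -> \bar R})
    (L : set (functional X m)) (C : set (functional X m.+1)) : \bar R :=
  modulus p mu [set S | C S /\ exists2 T, L T & boundary S = T].

End integral_currents.

(* Main.v *)
From HB Require Import structures.
Require Import Defs.
From mathcomp Require Import all_boot all_order all_algebra finmap.
From mathcomp Require Import all_classical all_reals all_analysis.
From mathcomp Require Import measurable_realfun.
From mathcomp Require Import ring lra.

Set Implicit Arguments.
Unset Strict Implicit.
Unset Printing Implicit Defensive.
Import Order.TTheory GRing.Theory Num.Theory.
Import numFieldNormedType.Exports.
Local Open Scope classical_set_scope.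
Local Open Scope ring_scope.

(** Let S be a filling of a nonzero cycle T supported in A, choose (f, pi)
with T(f, pi) <> 0, and let u be a Lipschitz cutoff that is 1 on a
neighbourhood V of A and 0 outside a larger neighbourhood U. As T lives on A,
the boundary relation gives T(f, pi) = T(u f, pi) = S(1, u f, pi). The last
value only feels the slope of u f, which is at most Lip(f) on V and at most
sup|f| slope(u) + Lip(f) on U \ V, so

  |T(f, pi)| <= prod Lip(pi_i)
      (sup|f| int_(U \ V) slope(u) d||S|| + Lip(f) ||S||(U)).

This is [filling_estimate]. If ||S||(A) = 0, the last term tends to 0 as U
shrinks to A, so the integral of the slope of u over the ring U \ V stays away
from 0. This lower bound depends on S, but it holds for all thin enough rings.

The cutoffs come from finite covers of A by balls B(x_j, r_j) with
sum_j r_j^(Q-p) <= M, where M does not depend on the size of the balls; such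
covers exist because H^(Q-p)(A) is finite ([compact_ball_cover]). The slope of
u at a point is at most the largest 1/r_j among the balls B(x_j, 3 r_j) that
contain it, so the growth bound on mu yields int slope(u)^p dmu <= C 3^Q M. The
same covers show mu(A) = 0.

Choosing the covers finer and finer makes the rings pairwise disjoint
([nested_covers]). Take weights a_n with sum a_n = oo and sum a_n^p as small as
desired; here p > 1 is essential. The density

  F = sum_n a_n slope(u_n) 1_(U_n \ V_n) + oo 1_A

satisfies int F^p dmu <= C 3^Q M sum a_n^p, because the rings are disjoint and
mu(A) = 0. Its integral against ||S|| is infinite for every filling S: either
||S||(A) > 0, or the n-th integral is at least a positive constant for all
large n while sum a_n diverges. So F is admissible, and its energy is as small
as desired.

Three facts about currents carry this argument. First, the mass
||T|| exists: the measures satisfying a mass bound are closed under patching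
along Borel sets, so their setwise infimum is a measure, and it satisfies the
bound again ([least_dominating_measure]). Second, S sees local slopes
([local_bound]): this is the minimality of the least measure dominating
f |-> S(f, w, pi), combined with the locality axiom. Third, ||T|| vanishes
off spt T because ||T|| is concentrated on a separable set, which is where the
rectifiability of T enters. *)

(** * Lipschitz functions *)

Section lipschitz_functions.
Context {R : realType} {X : pmetricType R}.
Implicit Types (f g : X -> R) (L M c : R).

Lemma lipschitz_realP f L : lipschitz_with (f : X -> R^o) L <->
  0 <= L /\ forall x y, `|f x - f y| <= L * mdist x y.
Proof.
by split=> -[L0 fL]; split => // x y; have := fL x y; rewrite /mdist/= distrC.
Qed.

Lemma LipP (f : lip X) : lipschitz_with (lip_fun f : X -> R^o) (Lip f).
Proof.
have [K fK] := lip_prop f.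
have h : has_inf [set L | lipschitz_with (lip_fun f : X -> R^o) L].
  by split; [exists K|exists 0 => L []].
split; first by apply: lb_le_inf; [exists K|move=> L []].
move=> x y; have [xy0|xy0] := eqVneq (mdist x y) 0.
  by rewrite (le_trans (fK.2 x y))// xy0 !mulr0.
have {}xy0 : 0 < mdist x y by rewrite lt_neqAle eq_sym xy0 mdist_ge0.
rewrite -ler_pdivrMr//; apply: lb_le_inf; first by exists K.
by move=> L [_ fL]; rewrite ler_pdivrMr.
Qed.

Lemma Lip_ge0 (f : lip X) : 0 <= Lip f. Proof. exact: (LipP f).1. Qed.

Lemma Lip_le (f : lip X) L : lipschitz_with (lip_fun f : X -> R^o) L ->
  Lip f <= L.
Proof.
by move=> fL; apply: ge_inf => //; exists 0 => K [].
Qed.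

(** Lets bounded Lipschitz functions be produced from pointwise formulas without
carrying the proofs packed in [lipb]. *)
Lemma lipb_ex f L M : lipschitz_with (f : X -> R^o) L ->
  (forall x, `|f x| <= M) -> exists u : lipb X, forall x, u x = f x.
Proof.
move=> fL fM; have h : lipschitz_map (f : X -> R^o) by exists L.
by exists (@MkLipb R X (MkLip h) (ex_intro _ M fM)).
Qed.

Lemma lipschitz_cst c : lipschitz_with ((fun=> c) : X -> R^o) 0.
Proof. by apply/lipschitz_realP; split => // x y; rewrite subrr normr0 mul0r. Qed.

Lemma lipschitzD f g L M : lipschitz_with (f : X -> R^o) L ->
  lipschitz_with (g : X -> R^o) M ->
  lipschitz_with ((fun x => f x + g x) : X -> R^o) (L + M).
Proof.
move=> /lipschitz_realP[L0 fL] /lipschitz_realP[M0 gM]; apply/lipschitz_realP; split; first exact: addr_ge0.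
move=> x y; rewrite opprD addrACA mulrDl (le_trans (ler_normD _ _))//.
by apply: lerD; [exact: fL|exact: gM].
Qed.

Lemma lipschitzN f L : lipschitz_with (f : X -> R^o) L ->
  lipschitz_with ((fun x => - f x) : X -> R^o) L.
Proof.
move=> /lipschitz_realP[L0 fL]; apply/lipschitz_realP; split => // x y.
by rewrite -opprD normrN; exact: fL.
Qed.

Lemma lipschitzB f g L M : lipschitz_with (f : X -> R^o) L ->
  lipschitz_with (g : X -> R^o) M ->
  lipschitz_with ((fun x => f x - g x) : X -> R^o) (L + M).
Proof. by move=> fL /lipschitzN; exact: lipschitzD. Qed.

Lemma lipschitzZ f L c : 0 <= c -> lipschitz_with (f : X -> R^o) L ->
  lipschitz_with ((fun x => c * f x) : X -> R^o) (c * L).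
Proof.
move=> c0 /lipschitz_realP[L0 fL]; apply/lipschitz_realP; split.
  exact: mulr_ge0.
by move=> x y; rewrite -mulrBr normrM ger0_norm// -mulrA ler_wpM2l.
Qed.

Lemma lipschitzM f g L M a b : lipschitz_with (f : X -> R^o) L ->
  lipschitz_with (g : X -> R^o) M ->
  (forall x, `|f x| <= a) -> (forall x, `|g x| <= b) ->
  lipschitz_with ((fun x => f x * g x) : X -> R^o) (a * M + b * L).
Proof.
move=> /lipschitz_realP[L0 fL] /lipschitz_realP[M0 gM] fa gb.
have a0 : 0 <= a := le_trans (normr_ge0 _) (fa point).
have b0 : 0 <= b := le_trans (normr_ge0 _) (gb point).
apply/lipschitz_realP; split; first by rewrite addr_ge0// mulr_ge0.
move=> x y.
have -> : f x * g x - f y * g y = f x * (g x - g y) + g y * (f x - f y) by ring.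
rewrite (le_trans (ler_normD _ _))// !normrM mulrDl; apply: lerD.
  by rewrite -mulrA ler_pM//; exact: gM.
by rewrite -mulrA ler_pM//; exact: fL.
Qed.

Lemma lipschitz_norm f L : lipschitz_with (f : X -> R^o) L ->
  lipschitz_with ((fun x => `|f x|) : X -> R^o) L.
Proof.
move=> /lipschitz_realP[L0 fL]; apply/lipschitz_realP; split => // x y.
exact: le_trans (ler_dist_dist _ _) (fL x y).
Qed.

Lemma lipschitz_max f g L M : lipschitz_with (f : X -> R^o) L ->
  lipschitz_with (g : X -> R^o) M ->
  lipschitz_with ((fun x => Num.max (f x) (g x)) : X -> R^o) (Num.max L M).
Proof.
move=> /lipschitz_realP[L0 fL] /lipschitz_realP[M0 gM]; apply/lipschitz_realP; split; first by rewrite le_max L0.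
move=> x y; set K := Num.max L M.
have fK : `|f x - f y| <= K * mdist x y.
  by rewrite (le_trans (fL x y))// ler_wpM2r ?mdist_ge0// le_max lexx.
have gK : `|g x - g y| <= K * mdist x y.
  by rewrite (le_trans (gM x y))// ler_wpM2r ?mdist_ge0// le_max lexx orbT.
move: fK gK; rewrite !ler_norml.
by move=> /andP[? ?] /andP[? ?]; apply/andP; split;
  case: (lerP (f x) (g x)) => ?; case: (lerP (f y) (g y)) => ?; lra.
Qed.

Lemma lipschitz_min f g L M : lipschitz_with (f : X -> R^o) L ->
  lipschitz_with (g : X -> R^o) M ->
  lipschitz_with ((fun x => Num.min (f x) (g x)) : X -> R^o) (Num.max L M).
Proof.
move=> /lipschitzN fL /lipschitzN gM.
have := lipschitzN (lipschitz_max fL gM).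
congr (lipschitz_with _ _); apply/funext => x /=.
by rewrite oppr_max !opprK.
Qed.

Lemma lipschitz_dist (a : X) : lipschitz_with ((fun x => mdist a x) : X -> R^o) 1.
Proof.
apply/lipschitz_realP; split => // x y; rewrite mul1r ler_norml.
have := metric_triangle a x y; have := metric_triangle a y x.
by rewrite (metric_sym y x); lra.
Qed.

Lemma lipschitz_continuous f L : lipschitz_with (f : X -> R^o) L -> continuous f.
Proof.
move=> /lipschitz_realP[L0 fL] x; apply/(@cvgrPdist_lt _ R^o) => e e0; near=> y.
rewrite (le_lt_trans (fL x y))//.
have : mdist x y < e / (L + 1).
  have : ball x (e / (L + 1)) y.
    near: y; apply: (@nbhsx_ballx _ _ x); rewrite divr_gt0//; lra.
  by rewrite ballEmdist.
rewrite ltr_pdivlMr ?ltr_wpDl//; have := mdist_ge0 x y.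
by move=> ?; nra.
Unshelve. all: by end_near. Qed.

Lemma measurable_open (U : set (borel X)) : open (U : set X) -> measurable U.
Proof. by move=> oU; exact: sub_sigma_algebra. Qed.

Lemma measurable_closed (U : set (borel X)) : closed (U : set X) -> measurable U.
Proof. by move=> /closed_openC/measurable_open; rewrite -{2}(setCK U); exact: measurableC. Qed.

Lemma measurable_continuous (f : borel X -> R) : continuous (f : X -> R) ->
  measurable_fun setT f.
Proof.
move=> /continuousP cf mD.
apply: (measurability _ (RGenOpens.measurableE R)) => //.
move=> _ [_ [a [b ->] <-]]; rewrite setTI; apply: measurable_open.
by apply: cf; apply: interval_open.
Qed.

End lipschitz_functions.

(** * Approximation of Borel sets by Lipschitz functions *)

Section approximation.
Context {R : realType} {X : pmetricType R}.
Variable nu : {measure set (borel X) -> \bar R}.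
Hypothesis nuT : (nu setT < +oo)%E.

(** Continuity from above, in the form of an explicit index. *)
Lemma measure_small (F : nat -> set (borel X)) (e : R) :
  (forall n, measurable (F n)) -> {homo F : m n / (m <= n)%N >-> n `<=` m} ->
  \bigcap_n F n = set0 -> 0 < e -> exists n, (nu (F n) <= e%:E)%E.
Proof.
move=> mF ndF F0 e0.
have := @nonincreasing_cvg_mu _ _ _ nu F.
rewrite F0 measure0 => /(_ _ mF measurable0) h.
have : nu (F n) @[n --> \oo] --> 0%E.
  apply: h.
  - by rewrite (le_lt_trans _ nuT)// le_measure// inE.
  - by move=> m n mn; apply/subsetPset; exact: ndF.
move=> /fine_cvgP[fin /cvgrPdist_le/(_ e e0) [N _ hN]].
case: fin => M _ hM.
exists (maxn N M); rewrite -(fineK (hM _ (leq_maxr N M))) lee_fin.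
have := hN _ (leq_maxl N M); rewrite /= sub0r normrN.
by apply: le_trans; rewrite ler_norm.
Qed.

(** Density of the bounded Lipschitz functions in L^1(nu), tested on indicators
with cutoffs valued in [0, 1]. *)
Definition lip_approx (E : set (borel X)) := forall e : R, 0 < e ->
  exists2 u : lipb X, (forall x, 0 <= u x <= 1) &
    (\int[nu]_x `|u x - \1_E x|%:E <= e%:E)%E.

Lemma measurable_lipb (u : lipb X) : measurable_fun setT (u : borel X -> R).
Proof. by apply: measurable_continuous; exact: lipschitz_continuous (LipP u). Qed.

Lemma measurable_lip_indic (u : lipb X) (E : set (borel X)) : measurable E ->
  measurable_fun setT (fun x : borel X => `|u x - \1_E x|%:E).
Proof.
move=> mE; apply/measurable_EFinP; apply: measurableT_comp => //.
apply: measurable_funB; first exact: measurable_lipb.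
exact: measurable_indic.
Qed.

Lemma lip_approx0 : lip_approx set0.
Proof.
move=> e e0; have [|u uE] := @lipb_ex R X _ _ 0 (lipschitz_cst 0).
  by move=> _; rewrite normr0.
exists u => [x|]; first by rewrite uE lexx ler01.
by rewrite integral0_eq ?lee_fin ?ltW// => x _; rewrite uE indic0 subrr normr0.
Qed.

Lemma lip_approxC E : lip_approx E -> lip_approx (~` E).
Proof.
move=> aE e e0; have [u u01 ue] := aE e e0.
have [|v vE] := @lipb_ex R X _ _ 1 (lipschitzB (lipschitz_cst 1) (LipP u)).
  by move=> x; have /andP[? ?] := u01 x; rewrite ger0_norm; lra.
exists v => [x|]; first by rewrite vE; have /andP[? ?] := u01 x; lra.
rewrite (le_trans _ ue)// le_eqVlt; apply/orP; left; apply/eqP.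
apply: eq_integral => x _ /=; rewrite vE -normrN; congr (`|_|%:E).
by rewrite !indicE in_setC; case: (x \in E) => /=; ring.
Qed.

Lemma lip_approxU E F : measurable E -> measurable F ->
  lip_approx E -> lip_approx F -> lip_approx (E `|` F).
Proof.
move=> mE mF aE aF e e0.
have e20 : 0 < e / 2 by lra.
have [u u01 ue] := aE _ e20; have [v v01 ve] := aF _ e20.
have [|w wE] := @lipb_ex R X _ _ 1 (lipschitz_max (LipP u) (LipP v)).
  move=> x; have /andP[? ?] := u01 x; have /andP[? ?] := v01 x.
  by case: (lerP (u x) (v x)) => _; rewrite ger0_norm.
exists w => [x|].
  rewrite wE; have /andP[? ?] := u01 x; have /andP[? ?] := v01 x.
  by case: (lerP (u x) (v x)) => _; lra.
- rewrite (splitr e) EFinD (le_trans _ (leeD ue ve))// -ge0_integralD//; first last.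
  + exact: measurable_lip_indic.
  + exact: measurable_lip_indic.
  apply: ge0_le_integral => //=.
  + by apply: measurable_lip_indic; exact: measurableU.
  + by apply: emeasurable_funD; exact: measurable_lip_indic.
  move=> x _; rewrite -EFinD lee_fin !indicE in_setU wE.
  have /andP[? ?] := u01 x; have /andP[? ?] := v01 x.
  by case: (x \in E); case: (x \in F) => /=; rewrite ?subr0;
    case: (lerP (u x) (v x)) => ?; rewrite ?(ler0_norm (_ : _ - 1 <= 0)) ?ger0_norm; lra.
Qed.

(** The functions min(1, n dist(x, ~U)) increase to the indicator of U. *)
Lemma lip_approx_open (U : set X) : open U -> lip_approx U.
Proof.
move=> oU; have [U0|/set0P[b Cb]] := eqVneq (~` U) set0.
  by rewrite -(setCK U) U0; exact/lip_approxC/lip_approx0.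
move=> e e0.
(* d is the distance to the complement of U, which is nonempty here. *)
pose D x := [set mdist x y | y in ~` U]; pose d x := inf (D x).
have D0 x : D x !=set0 by exists (mdist x b), b.
have lbD x : has_lbound (D x) by exists 0 => _ [y _ <-]; exact: mdist_ge0.
have d_ge0 x : 0 <= d x by apply: lb_le_inf => // _ [y _ <-]; exact: mdist_ge0.
have dlip x y : d x <= d y + mdist x y.
  rewrite -lerBlDr; apply: lb_le_inf => // _ [z Uz <-]; rewrite lerBlDr addrC.
  by rewrite (le_trans _ (metric_triangle x y z))//; apply: ge_inf => //; exists z.
have dL : lipschitz_with (d : X -> R^o) 1.
  apply/lipschitz_realP; split => // x y; rewrite mul1r ler_norml.
  by have := dlip x y; have := dlip y x; rewrite (metric_sym y x); lra.
have d_out x : ~ U x -> d x = 0.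
  move=> Ux; apply/eqP; rewrite eq_le d_ge0 andbT; apply: ge_inf => //.
  by exists x => //; rewrite mdistxx.
have d_in x : U x -> 0 < d x.
  move=> Ux; have /nbhs_ballP[r /= r0 rU] : nbhs x U by exact: open_nbhs_nbhs.
  apply: (lt_le_trans r0); apply: lb_le_inf => // _ [z Uz <-].
  rewrite leNgt; apply/negP => zr; apply/Uz/rU.
  by rewrite ballEmdist.
have md : measurable_fun setT (d : borel X -> R).
  by apply: measurable_continuous; exact: lipschitz_continuous dL.
pose F n : set (borel X) := U `&` [set x | n.+1%:R * d x < 1].
have mF n : measurable (F n).
  apply: measurableI; first exact: measurable_open.
  rewrite (_ : [set _ | _] = (fun x : borel X => n.+1%:R * d x) @^-1` `]-oo, 1[%classic).
    by rewrite -[X in measurable X]setTI; apply: measurable_funM.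
  by apply/seteqP; split => x /=; rewrite in_itv.
have [||n hn] := measure_small mF _ _ e0.
- move=> m n mn x [Ux /= h]; split => //=; apply: le_lt_trans h.
  by rewrite ler_wpM2r// ler_nat.
- rewrite -subset0 => x Fx; have [Ux _] := Fx 0%N I.
  have [n hn] : exists n : nat, (d x)^-1 < n.+1%:R.
    exists (Num.trunc (d x)^-1); exact: truncnS_gt.
  have [_ /=] := Fx n I; rewrite ltNge => /negP; apply.
  by rewrite -ler_pdivrMr ?d_in// div1r ltW.
have nL := lipschitz_min (lipschitz_cst 1) (lipschitzZ (ler0n R n.+1) dL).
have [|u uE] := @lipb_ex R X _ _ 1 nL.
  by move=> x; rewrite ger0_norm ?le_min ?ler01 ?mulr_ge0// ge_min lexx.
exists u => [x|]; first by rewrite uE ge_min lexx le_min ler01 mulr_ge0.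
rewrite (le_trans _ hn)// -[F n]setIT -integral_indic//.
apply: ge0_le_integral => //=.
- by apply: measurable_lip_indic; exact: measurable_open.
- by apply/measurable_EFinP; exact: measurable_indic.
move=> x _; rewrite lee_fin !indicE uE.
have [Ux|Ux] := boolP (x \in U); last first.
  rewrite d_out ?mulr0; last by move=> /mem_set; apply/negP.
  by rewrite (min_idPr ler01) subrr normr0 ler0n.
have [nd|nd] := lerP 1 (n.+1%:R * d x); first by rewrite subrr normr0 ler0n.
rewrite (_ : x \in F n) ?mem_set//=; last by split => //; exact: set_mem.
have : 0 <= n.+1%:R * d x by rewrite mulr_ge0.
by move=> ?; rewrite ler0_norm; lra.
Qed.

(** The measure is finite, so a countable union may be replaced by a finite one
at the cost of a small set. *)
Lemma lip_approx_bigcup (F : nat -> set (borel X)) :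
  (forall n, measurable (F n)) -> (forall n, lip_approx (F n)) ->
  lip_approx (\bigcup_n F n).
Proof.
move=> mF aF; have mU : measurable (\bigcup_n F n) by exact: bigcup_measurable.
pose G n := \big[setU/set0]_(i < n) F i.
have mG n : measurable (G n) by exact: bigsetU_measurable.
have aG n : lip_approx (G n).
  rewrite /G; elim: n => [|n ih]; first by rewrite big_ord0; exact: lip_approx0.
  by rewrite big_ord_recr /=; apply: lip_approxU => //; exact: mG n.
move=> e e0; have e20 : 0 < e / 2 by lra.
have [|||n hn] := @measure_small (fun n => \bigcup_k F k `\` G n) _ _ _ _ e20.
+ by move=> n; exact: measurableD.
+ move=> m n mn x [Fx Gx]; split => // Gm; apply: Gx; move: Gm.
  rewrite /G -!bigcup_mkord => -[k /= km Fk]; exists k => //=.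
  exact: leq_trans km mn.
+ rewrite -subset0 => x Fx; have [[k _ Fk] _] := Fx 0%N I.
  have [_] := Fx k.+1 I; apply; rewrite /G -bigcup_mkord; exists k => //=.
have [u u01 ue] := aG n _ e20; exists u => //.
rewrite (splitr e) EFinD (le_trans _ (leeD hn ue))//.
rewrite -[_ `\` G n]setIT -integral_indic//; last exact: measurableD.
rewrite -ge0_integralD//; first last.
+ exact: measurable_lip_indic.
+ by apply/measurable_EFinP; apply: measurable_indic; exact: measurableD.
apply: ge0_le_integral => //=.
+ exact: measurable_lip_indic.
+ apply: emeasurable_funD; last exact: measurable_lip_indic.
  by apply/measurable_EFinP; apply: measurable_indic; exact: measurableD.
move=> x _; rewrite -EFinD lee_fin !indicE in_setD.
have [Gx|Gx] /= := boolP (x \in G n).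
  rewrite mem_set ?andbF//= ?add0r//; move/set_mem: Gx.
  by rewrite /G -bigcup_mkord => -[k _ ?]; exists k.
have /andP[? ?] := u01 x.
by case: (x \in \bigcup_n F n) => /=; rewrite ?subr0 ?add0r//
  (ler0_norm (_ : _ - 1 <= 0)) ?ger0_norm; lra.
Qed.

(** The sets that can be approximated form a sigma-algebra containing the open
sets. *)
Lemma measurable_lip_approx E : measurable E -> lip_approx E.
Proof.
suff : (@measurable _ (borel X)) `<=` [set E | measurable E /\ lip_approx E].
  by move=> h mE; have [] := h E mE.
apply: smallest_sub; last first.
  by move=> U oU; split; [exact: measurable_open|exact: lip_approx_open].
split.
- by split => //; exact: lip_approx0.
- move=> Z [mZ aZ]; rewrite setTD; split; first exact: measurableC.
  exact: lip_approxC.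
- move=> F FP; split; first by apply: bigcup_measurable => n _; have [] := FP n.
  by apply: lip_approx_bigcup => n; have [] := FP n.
Qed.

End approximation.

(** * The least measure dominating a family of functionals *)

Section least_measure.
Context {R : realType} {X : pmetricType R} {J : Type}.
Variables (lam : J -> lipb X -> R) (K : J -> R).
Hypothesis K_ge0 : forall i, 0 <= K i.
Hypothesis lamD : forall i (f g h : lipb X),
  (forall x, h x = f x + g x) -> lam i h = lam i f + lam i g.
Implicit Types nu : {measure set (borel X) -> \bar R}.

(** The mass bound of a current is the case where [J] is the type of the tuples
pi and [K pi] is the product of their Lipschitz constants. A single functional
is the case where [J] is [unit]. *)
Definition dominating nu := [/\ (nu setT < +oo)%E &
  forall i (f : lipb X),
    (`|lam i f|%:E <= (K i)%:E * \int[nu]_x `|f x|%:E)%E].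

Lemma integral_mrestr nu (E : set (borel X)) (mE : measurable E)
    (f : borel X -> \bar R) :
  measurable_fun setT f -> (forall x, 0 <= f x)%E ->
  (\int[mrestr nu mE]_x f x = \int[nu]_(x in E) f x)%E.
Proof.
move=> mf f0; have mC : measurable (~` E) by exact: measurableC.
rewrite -(setUv E) ge0_integral_setU ?setUv//; last by rewrite disj_set2E setICr eqxx.
have -> : (\int[mrestr nu mE]_(x in ~` E) f x = 0)%E.
  apply: null_set_integral => //; first by apply: measurable_funS mf.
  by rewrite /= /mrestr setICl measure0.
rewrite adde0; apply: eq_measure_integral => A mA AE; rewrite /= /mrestr.
by rewrite setIidl.
Qed.

Definition patch_measure nu1 nu2 (E : set (borel X)) (mE : measurable E) :=
  measure_add (mrestr nu1 mE) (mrestr nu2 (measurableC mE)).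

Lemma measurable_norm_lipb (f : lipb X) :
  measurable_fun setT (fun x : borel X => `|f x|%:E).
Proof.
by apply/measurable_EFinP; apply: measurableT_comp => //; exact: measurable_lipb.
Qed.

(** Bounds the price of replacing the indicator of [E] by a Lipschitz cutoff. *)
Lemma cutoff_integral_le nu (E F : set (borel X)) (f u w : lipb X) (c : R) :
  measurable E -> measurable F -> 0 <= c ->
  (forall x, `|w x| <= `|f x| * \1_E x + c * `|u x - \1_F x|) ->
  (\int[nu]_x `|w x|%:E <=
   \int[nu]_(x in E) `|f x|%:E + c%:E * \int[nu]_x `|u x - \1_F x|%:E)%E.
Proof.
move=> mE mF c0 h; rewrite [X in (_ <= X + _)%E]integral_mkcond -ge0_integralZl//; last first.
- exact: measurable_lip_indic.
have mf : measurable_fun setT ((fun x : borel X => `|f x|%:E) \_ E).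
  apply/(measurable_restrictT _ _).1 => //.
  by apply: measurable_funS (measurable_norm_lipb f).
have mu : measurable_fun setT (fun x : borel X => c%:E * `|u x - \1_F x|%:E)%E.
  by apply: measurable_funeM; exact: measurable_lip_indic.
rewrite -ge0_integralD//; first last.
- by move=> x _; rewrite -EFinM lee_fin mulr_ge0.
- by move=> x _; rewrite patchE; case: ifP.
apply: ge0_le_integral => //.
- exact: measurable_norm_lipb.
- exact: emeasurable_funD.
move=> x _; rewrite patchE -EFinM.
by have := h x; rewrite indicE; case: (x \in E) => /=;
  rewrite ?mulr1 ?mulr0 -?EFinD ?add0e ?add0r lee_fin.
Qed.

Lemma patch_error_bound (k c d e : R) (a b p q : \bar R) :
  0 <= k -> 0 <= c -> (0 <= a)%E -> (0 <= b)%E -> (0 <= p)%E -> (0 <= q)%E ->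
  (p + q <= d%:E)%E -> k * (c * d) <= e ->
  (k%:E * (a + c%:E * p) + k%:E * (b + c%:E * q) <= k%:E * (a + b) + e%:E)%E.
Proof.
move=> k0 c0 a0 b0 p0 q0 pq kcd; have cE0 : (0 <= c%:E)%E by [].
rewrite !ge0_muleDr ?mule_ge0//.
rewrite addeACA leeD2l// -!ge0_muleDr ?mule_ge0//.
have kcdE : (k%:E * (c%:E * d%:E) <= e%:E)%E by rewrite -!EFinM lee_fin.
by rewrite (le_trans _ kcdE)// lee_wpmul2l// lee_wpmul2l.
Qed.

(** Write f = u f + (1 - u) f with a Lipschitz cutoff u close to the indicator of
[E] in L^1(nu1 + nu2), and bound the two parts by nu1 and nu2 respectively. *)
Lemma dominating_patch nu1 nu2 E (mE : measurable E) :
  dominating nu1 -> dominating nu2 -> dominating (patch_measure nu1 nu2 mE).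
Proof.
move=> [fin1 dom1] [fin2 dom2]; split.
  rewrite [X in (X < _)%E]measure_addE; apply: lte_add_pinfty.
    rewrite /mrestr; apply: le_lt_trans fin1.
    by apply: le_measure; rewrite ?inE// setTI.
  rewrite /mrestr; apply: le_lt_trans fin2.
  by apply: le_measure; rewrite ?inE// setTI; exact: measurableC.
move=> i f; apply/lee_addgt0Pr => e e0.
have [c fc] := lipb_prop f.
have c0 : 0 <= c := le_trans (normr_ge0 _) (fc point).
pose nu := measure_add nu1 nu2.
have nuT : (nu setT < +oo)%E.
  by rewrite [X in (X < _)%E]measure_addE; exact: lte_add_pinfty.
have d0 : 0 < K i * c + 1 by rewrite ltr_wpDl// mulr_ge0.
have [u u01 ue] := measurable_lip_approx nuT mE (divr_gt0 e0 d0).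
move: ue; rewrite /nu ge0_integral_measure_add//; last exact: measurable_lip_indic.
move=> ue.
have u1 x : `|u x| <= 1 by have /andP[? ?] := u01 x; rewrite ger0_norm.
have u1' x : `|1 - u x| <= 1.
  by have /andP[? ?] := u01 x; rewrite ger0_norm; lra.
have [|v vE] := @lipb_ex R X _ _ c (lipschitzM (LipP u) (LipP f) u1 fc).
  by move=> x; rewrite normrM -[c]mul1r ler_pM.
have [|w wE] := @lipb_ex R X _ _ c (lipschitzM
   (lipschitzB (lipschitz_cst 1) (LipP u)) (LipP f) u1' fc).
  by move=> x; rewrite normrM -[c]mul1r ler_pM.
have fc0 x : 0 <= `|f x| by [].
have le1 : (\int[nu1]_x `|v x|%:E <= \int[nu1]_(x in E) `|f x|%:E +
    c%:E * \int[nu1]_x `|u x - \1_E x|%:E)%E.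
  apply: cutoff_integral_le => // x; rewrite vE normrM indicE.
  have /andP[u0 u1x] := u01 x; rewrite (ger0_norm u0).
  case: (x \in E) => /=; rewrite ?mulr1 ?mulr0 ?add0r ?subr0.
    by rewrite ler_wpDr ?mulr_ge0// ler_piMl.
  by rewrite (ger0_norm u0) mulrC ler_wpM2r.
have le2 : (\int[nu2]_x `|w x|%:E <= \int[nu2]_(x in ~` E) `|f x|%:E +
    c%:E * \int[nu2]_x `|u x - \1_E x|%:E)%E.
  apply: cutoff_integral_le => //; first exact: measurableC.
  move=> x; rewrite wE normrM !indicE in_setC.
  have /andP[u0 u1x] := u01 x; have v0 : 0 <= 1 - u x by rewrite subr_ge0.
  rewrite (ger0_norm v0).
  case: (x \in E) => /=; rewrite ?mulr1 ?mulr0 ?add0r ?subr0.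
    by rewrite distrC (ger0_norm v0) mulrC ler_wpM2r.
  by rewrite ler_wpDr ?mulr_ge0// ler_piMl// gerBl.
rewrite /patch_measure ge0_integral_measure_add//; last exact: measurable_norm_lipb.
rewrite !integral_mrestr//; try exact: measurable_norm_lipb.
have -> : lam i f = lam i v + lam i w.
  by apply: lamD => x; rewrite vE wE; ring.
rewrite (@le_trans _ _ ((K i)%:E * \int[nu1]_x `|v x|%:E + (K i)%:E * \int[nu2]_x `|w x|%:E)%E)//.
  by rewrite (@le_trans _ _ (`|lam i v|%:E + `|lam i w|%:E)%E)// ?leeD// -EFinD lee_fin ler_normD.
have K0 : (0 <= (K i)%:E)%E by rewrite lee_fin.
rewrite (le_trans (leeD (lee_wpmul2l K0 le1) (lee_wpmul2l K0 le2)))//.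
set a := (\int[nu1]_(x in E) _)%E; set b := (\int[nu2]_(x in ~` E) _)%E.
have a0 : (0 <= a)%E by apply: integral_ge0.
have b0 : (0 <= b)%E by apply: integral_ge0.
move: ue; set p := (\int[nu1]_x _)%E; set q := (\int[nu2]_x _)%E => ue.
have p0 : (0 <= p)%E by apply: integral_ge0.
have q0 : (0 <= q)%E by apply: integral_ge0.
have cE0 : (0 <= c%:E)%E by [].
apply: patch_error_bound ue _ => //.
by rewrite !mulrA ler_pdivrMr// mulrDr mulr1 [leLHS]mulrC lerDl ltW.
Qed.

Section infimum.
Variable nu0 : {measure set (borel X) -> \bar R}.
Hypothesis dom0 : dominating nu0.

(** A setwise infimum of measures is not a measure in general; here it is one
because the family is closed under patching. *)
Definition inf_measure (B : set (borel X)) : \bar R :=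
  ereal_inf [set nu B | nu in dominating].

Lemma inf_measure_le nu B : dominating nu -> (inf_measure B <= nu B)%E.
Proof. by move=> d; apply: ereal_inf_lbound; exists nu. Qed.

Lemma inf_measure_ge0 B : (0 <= inf_measure B)%E.
Proof. by apply: le_ereal_inf_tmp => _ [nu _ <-]. Qed.

Lemma inf_measure_fin B : measurable B -> inf_measure B \is a fin_num.
Proof.
move=> mB; rewrite ge0_fin_numE ?inf_measure_ge0//.
rewrite (le_lt_trans (inf_measure_le _ dom0))//.
by rewrite (le_lt_trans _ dom0.1)// le_measure// inE.
Qed.

Lemma inf_measure_approx B (e : R) : measurable B -> 0 < e ->
  exists2 nu, dominating nu & (nu B <= inf_measure B + e%:E)%E.
Proof.
move=> mB e0.
have [_ [nu dnu <-] h] := lb_ereal_inf_adherent e0 (inf_measure_fin mB).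
by exists nu => //; exact: ltW.
Qed.

Lemma inf_measure0 : inf_measure set0 = 0%E.
Proof.
apply/eqP; rewrite eq_le inf_measure_ge0 andbT.
by rewrite (le_trans (inf_measure_le _ dom0))// measure0.
Qed.

(** Patching a measure that is nearly optimal on [A] with one that is nearly
optimal on [B] gives a measure that is nearly optimal on both. *)
Lemma inf_measureU A B : measurable A -> measurable B -> A `&` B = set0 ->
  inf_measure (A `|` B) = (inf_measure A + inf_measure B)%E.
Proof.
move=> mA mB AB; apply/eqP; rewrite eq_le; apply/andP; split.
  apply/lee_addgt0Pr => e e0; have e20 : 0 < e / 2 by lra.
  have [nu1 d1 h1] := inf_measure_approx mA e20.
  have [nu2 d2 h2] := inf_measure_approx mB e20.
  rewrite (splitr e) EFinD addeACA (le_trans _ (leeD h1 h2))//.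
  rewrite (le_trans (inf_measure_le _ (dominating_patch mA d1 d2)))//.
  rewrite [leLHS]measure_addE /= /mrestr leeD//.
    by rewrite setIUl setIid (setIC B) AB setU0.
  rewrite le_measure ?inE//.
    by apply: measurableI; [exact: measurableU|exact: measurableC].
  by move=> x [[]].
apply: le_ereal_inf_tmp => _ [nu d <-].
by rewrite measureU// leeD// inf_measure_le.
Qed.

Lemma inf_measure_bigsetU (F : nat -> set (borel X)) n :
  (forall i, measurable (F i)) -> trivIset setT F ->
  inf_measure (\big[setU/set0]_(i < n) F i) = (\sum_(0 <= i < n) inf_measure (F i))%E.
Proof.
move=> mF tF; elim: n => [|n ih].
  by rewrite big_ord0 big_geq// inf_measure0.
rewrite big_ord_recr big_nat_recr//= -ih inf_measureU//.
  exact: bigsetU_measurable.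
rewrite -bigcup_mkord -subset0 => x [[k /= kn Fk] Fn].
have := tF k n I I (ex_intro _ x (conj Fk Fn)) => kE.
by move: kn; rewrite kE ltnn.
Qed.

(** Finite additivity, together with the tails of a union being small for [nu0]
and therefore for the infimum. *)
Lemma inf_measure_sigma_additive : semi_sigma_additive inf_measure.
Proof.
move=> F mF tF mU.
pose G n := \big[setU/set0]_(i < n) F i.
have mG n : measurable (G n) by exact: bigsetU_measurable.
have GU n : G n `<=` \bigcup_k F k.
  by rewrite /G -bigcup_mkord => x [k _ Fk]; exists k.
have split_ n : inf_measure (\bigcup_k F k) =
    (\sum_(0 <= i < n) inf_measure (F i) + inf_measure (\bigcup_k F k `\` G n))%E.
  rewrite -inf_measure_bigsetU// -inf_measureU//.
  - by rewrite -/(G n) setDUK//; exact: GU.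
  - exact: mG.
  - exact: measurableD.
  - by rewrite -/(G n) setDIK.
have cv : cvgn (fun n => \sum_(0 <= i < n) inf_measure (F i))%E.
  by apply: is_cvg_nneseries => n _ _; exact: inf_measure_ge0.
suff -> : inf_measure (\bigcup_n F n) =
    limn (fun n => \sum_(0 <= i < n) inf_measure (F i))%E by exact: cv.
apply/eqP; rewrite eq_le; apply/andP; split; last first.
  apply: lime_le => //; apply: nearW => n; rewrite (split_ n).
  by rewrite leeDl// inf_measure_ge0.
apply/lee_addgt0Pr => e e0.
have [|||n hn] := @measure_small _ _ nu0 dom0.1 (fun n => \bigcup_k F k `\` G n) _ _ _ _ e0.
- by move=> n; exact: measurableD.
- move=> m n mn x [Fx Gx]; split => // Gm; apply: Gx; move: Gm.
  rewrite /G -!bigcup_mkord => -[k /= km Fk]; exists k => //=.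
  exact: leq_trans km mn.
- rewrite -subset0 => x Fx; have [[k _ Fk] _] := Fx 0%N I.
  have [_] := Fx k.+1 I; apply; rewrite /G -bigcup_mkord; exists k => //=.
rewrite (split_ n) leeD//.
  by apply: nneseries_lim_ge => i _ _; exact: inf_measure_ge0.
exact: le_trans (inf_measure_le _ dom0) hn.
Qed.

HB.instance Definition _ := isMeasure.Build _ _ _ inf_measure
  inf_measure0 inf_measure_ge0 inf_measure_sigma_additive.

(** The bound passes to the infimum because one dominating measure whose total
mass is nearly minimal has, against the bounded function |f|, nearly the same
integral as the infimum. *)
Lemma dominating_inf : dominating inf_measure.
Proof.
have infT : (inf_measure setT < +oo)%E.
  by rewrite (le_lt_trans (inf_measure_le _ dom0))// dom0.1.
split=> // i f; apply/lee_addgt0Pr => e e0.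
have [c fc] := lipb_prop f.
have c0 : 0 <= c := le_trans (normr_ge0 _) (fc point).
have d0 : 0 < K i * c + 1 by rewrite ltr_wpDl// mulr_ge0.
have [nu [nuT dnu] nule] := inf_measure_approx measurableT (divr_gt0 e0 d0).
set k := (\int[inf_measure]_x `|f x|%:E)%E.
set a := (\int[nu]_x `|f x|%:E)%E.
(* The nonnegative function c - |f| turns the bound on total masses into a bound
   on the integrals of |f|, since integrals increase with the measure. *)
pose g x := (c - `|f x|)%:E.
have g0 x : (0 <= g x)%E by rewrite lee_fin subr_ge0.
have mg : measurable_fun setT (g : borel X -> \bar R).
  apply/measurable_EFinP; apply: measurable_funB => //.
  by apply: measurableT_comp => //; exact: measurable_lipb.
have splitm (m : {measure set (borel X) -> \bar R}) :
    (c%:E * m setT = \int[m]_x g x + \int[m]_x `|f x|%:E)%E.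
  rewrite -ge0_integralD//; last exact: measurable_norm_lipb.
  rewrite -integral_cst//; apply: eq_integral => x _.
  by rewrite /g -EFinD subrK.
have gle : (\int[inf_measure]_x g x <= \int[nu]_x g x)%E.
  by apply: ge0_le_measure_integral => // S mS; exact: inf_measure_le.
rewrite (le_trans (dnu i f))// -/a.
have ak : (a <= k + (c * (e / (K i * c + 1)))%:E)%E.
  have gfin : (\int[inf_measure]_x g x \is a fin_num)%E.
    rewrite ge0_fin_numE ?integral_ge0//.
    apply: (@le_lt_trans _ _ (c%:E * inf_measure setT)%E).
      by rewrite [leRHS](splitm inf_measure) leeDl// integral_ge0.
    by rewrite -(fineK (inf_measure_fin measurableT)) -EFinM ltry.
  rewrite -(leeD2lE _ _ gfin) (@le_trans _ _ (c%:E * nu setT)%E)//.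
    by rewrite splitm leeD2r.
  rewrite addeA -[X in (_ <= X + _)%E](splitm inf_measure).
  by rewrite EFinM -ge0_muleDr ?inf_measure_ge0// ?lee_fin ?divr_ge0 ?(ltW d0) ?(ltW e0)// lee_wpmul2l.
have q0 : 0 <= e / (K i * c + 1) by rewrite divr_ge0// ltW.
rewrite (le_trans (lee_wpmul2l _ ak)) ?lee_fin// ge0_muleDr ?integral_ge0// ?lee_fin ?(mulr_ge0 c0 q0)//.
rewrite leeD2l// -EFinM lee_fin.
by rewrite !mulrA ler_pdivrMr// mulrDr mulr1 [leLHS]mulrC lerDl ltW.
Qed.

Lemma least_dominating_measure :
  exists2 k : {measure set (borel X) -> \bar R}, dominating k &
    forall nu, dominating nu -> forall B, measurable B -> (k B <= nu B)%E.
Proof.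
exists inf_measure => [|nu dnu B mB]; first exact: dominating_inf.
exact: inf_measure_le.
Qed.

End infimum.

End least_measure.

(** * Mass and locality of currents *)

Section mass_of_currents.
Context {R : realType} {X : pmetricType R}.

Definition lip_prod m (s : 'I_m -> lip X) : R := \prod_i Lip (s i).

Lemma lip_prod_ge0 m (s : 'I_m -> lip X) : 0 <= lip_prod s.
Proof. by apply: prodr_ge0 => i _; exact: Lip_ge0. Qed.

Definition bounds_mass m (T : functional X m)
    (nu : {measure set (borel X) -> \bar R}) :=
  dominating (fun s f => T f s) (@lip_prod m) nu.

Lemma current_addl m (T : functional X m) : is_current T ->
  forall s (f g h : lipb X), (forall x, h x = f x + g x) ->
  T h s = T f s + T g s.
Proof.
move=> [[Tl _] _ _ _] s f g h hE; rewrite (Tl 1 f g h s) ?mul1r// => x.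
by rewrite mul1r.
Qed.

Lemma bounds_massP m (T : functional X m)
    (nu : {finite_measure set (borel X) -> \bar R}) :
  mass_bound T nu <-> bounds_mass T nu.
Proof.
split=> [h|[_ h]]; last by move=> f s; exact: h.
split; last by move=> s f; exact: h.
by rewrite ltey_eq fin_num_measure.
Qed.

(** [mass] is a genuine least measure for every current, never the default
value of its definition. *)
Lemma current_mass m (T : functional X m) : is_current T ->
  bounds_mass T (mass T) /\
  forall nu, bounds_mass T nu ->
    forall B, measurable B -> (mass T B <= nu B)%E.
Proof.
move=> cT; have [_ _ _ [nu0 nu0T]] := cT.
have [k dk kmin] := least_dominating_measure (@lip_prod_ge0 m)
  (current_addl cT) ((bounds_massP T nu0).1 nu0T).
have ex : exists nu, is_mass T nu.
  have kT := dk.1.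
  exists (mfrestr measurableT kT); split.
    move=> f s; have [_ /(_ s f)] := dk.
    congr (_ <= _ * _)%E; apply: eq_measure_integral => A mA _.
    by rewrite /= /mfrestr /mrestr setIT.
  move=> nu' nu'T B mB; rewrite /= /mfrestr /mrestr setIT.
  by apply: kmin => //; exact/bounds_massP.
rewrite /mass; case: pselect => // ex'.
case: (cid ex') => nu [/= nuT numin]; split; first exact/bounds_massP.
move=> nu' nu'T B mB.
have nu'f : mass_bound T (mfrestr measurableT nu'T.1).
  move=> f s; have [_ /(_ s f)] := nu'T.
  congr (_ <= _ * _)%E; apply: eq_measure_integral => A mA _.
  by rewrite /= /mfrestr /mrestr setIT.
by have := numin _ nu'f B mB; rewrite /= /mfrestr /mrestr setIT.
Qed.

End mass_of_currents.

Section locality.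
Context {R : realType} {X : pmetricType R} {m : nat}.
Variable T : functional X m.+1.
Hypothesis cT : is_current T.
Variable nu : {measure set (borel X) -> \bar R}.
Hypothesis nuT : bounds_mass T nu.
Implicit Types (w : lip X) (s : 'I_m -> lip X) (f : lipb X).

Lemma fcons0 w s : fcons w s ord0 = w.
Proof. by rewrite /fcons unlift_none. Qed.

Lemma fcons_lift w s i : fcons w s (lift ord0 i) = s i.
Proof. by rewrite /fcons liftK. Qed.

Lemma lip_prod_fcons w s : lip_prod (fcons w s) = Lip w * lip_prod s.
Proof.
rewrite /lip_prod big_ord_recl fcons0; congr (_ * _).
by apply: eq_bigr => i _; rewrite fcons_lift.
Qed.

Lemma current_addr f (w w1 w2 : lip X) s : (forall x, w x = w1 x + w2 x) ->
  T f (fcons w s) = T f (fcons w1 s) + T f (fcons w2 s).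
Proof.
move=> wE; have [[_ Tl] _ _ _] := cT.
rewrite (Tl ord0 1 f (fcons w1 s) (fcons w2 s)) ?mul1r//.
- move=> j j0; case: (unliftP ord0 j) j0 => [i -> _|->]; last by rewrite eqxx.
  by rewrite !fcons_lift.
- by move=> x; rewrite !fcons0 mul1r.
Qed.

Lemma bounds_mass_fcons f w s L : lipschitz_with (lip_fun w : X -> R^o) L ->
  (`|T f (fcons w s)|%:E <= (lip_prod s)%:E * (L%:E * \int[nu]_x `|f x|%:E))%E.
Proof.
move=> wL; have [_ /(_ (fcons w s) f)] := nuT.
move=> /le_trans; apply; rewrite lip_prod_fcons mulrC EFinM -muleA.
rewrite lee_wpmul2l ?lee_fin ?lip_prod_ge0//.
by rewrite lee_wpmul2r ?integral_ge0// lee_fin Lip_le.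
Qed.

(** The locality axiom with the first form constant, equal to 0, where f does not
vanish; the Borel sets attached to the other forms are empty. *)
Lemma eq0_on_fcons f w s : (forall x, f x != 0 -> w x = 0) ->
  T f (fcons w s) = 0.
Proof.
move=> fw; have [_ _ Tloc _] := cT.
have mw : measurable_fun setT (w : borel X -> R).
  by apply: measurable_continuous; exact: lipschitz_continuous (LipP w).
pose B (i : 'I_m.+1) : set (borel X) := if i == ord0 then w @^-1` [set 0] else set0.
apply: (Tloc f (fcons w s) B).
- move=> i; rewrite /B; case: ifP => _ //.
  by rewrite -[X in measurable X]setTI; exact: mw.
- move=> i; rewrite /B; case: eqP => [->|_]; last by exists 0.
  by exists 0 => x; rewrite fcons0.
- by move=> x /= fx; exists ord0 => //; rewrite /B eqxx /=; exact: fw.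
Qed.


(** Moves every real number towards 0 by [d], so that a whole neighbourhood of
the zero set of w becomes part of the zero set of the truncation of w. *)
Definition truncate (d t : R) := Num.max (t - d) 0 + Num.min (t + d) 0.

Lemma truncate0 d t : `|t| <= d -> truncate d t = 0.
Proof.
rewrite ler_norml /truncate => /andP[? ?].
by rewrite max_r ?min_r ?addr0//; lra.
Qed.

Lemma truncate_dist d t : 0 <= d -> `|truncate d t - t| <= d.
Proof.
move=> d0; rewrite /truncate ler_norml; apply/andP.
by case: (lerP (t - d) 0) => ?; case: (lerP (t + d) 0) => ?; split; lra.
Qed.

Lemma lipschitz_truncate (w : X -> R) L d : lipschitz_with (w : X -> R^o) L ->
  lipschitz_with ((fun x => truncate d (w x)) : X -> R^o) (2 * L).
Proof.
move=> wL; have L0 := wL.1.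
have h1 := lipschitz_max (lipschitzB wL (lipschitz_cst d)) (lipschitz_cst 0).
have h2 := lipschitz_min (lipschitzD wL (lipschitz_cst d)) (lipschitz_cst 0).
have := lipschitzD h1 h2.
by rewrite addr0 max_l// -mulr2n mulr_natl.
Qed.

Lemma measurable_neq0 w : measurable [set x : borel X | (w x != 0)%R].
Proof.
rewrite (_ : [set _ | _] = (w : borel X -> R) @^-1` (~` [set 0])).
  rewrite -[X in measurable X]setTI; apply: measurable_continuous => //.
    exact: lipschitz_continuous (LipP w).
  exact: measurableC.
by apply/seteqP; split => x /eqP.
Qed.

(** On the open set |w| < d the truncated form vanishes, so f may be replaced by
f min(1, |w| / d), which is 0 wherever w is. *)
Lemma bounds_mass_truncate f w s L d : 0 < d ->
  lipschitz_with (lip_fun w : X -> R^o) L ->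
  forall w' : lip X, (forall x, w' x = truncate d (w x)) ->
  (`|T f (fcons w' s)|%:E <= (lip_prod s)%:E *
    ((2 * L)%:E * \int[nu]_(x in [set x | (w x != 0)%R]) `|f x|%:E))%E.
Proof.
move=> d0 wL w' w'E.
have L0 := wL.1.
have w'L : lipschitz_with (lip_fun w' : X -> R^o) (2 * L).
  by rewrite (_ : lip_fun w' = (fun x => truncate d (w x))) ?funeqE//; exact: lipschitz_truncate.
have di0 : 0 <= d^-1 by rewrite invr_ge0 ltW.
have kL := lipschitz_min (lipschitz_cst 1) (lipschitzZ di0 (lipschitz_norm wL)).
pose k x := Num.min 1 (d^-1 * `|w x|).
have k0 x : 0 <= k x by rewrite /k le_min ler01 mulr_ge0.
have k1 x : k x <= 1 by rewrite /k ge_min lexx.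
have kn x : `|k x| <= 1 by rewrite ger0_norm.
have kn' x : `|1 - k x| <= 1 by rewrite ger0_norm ?subr_ge0// gerBl.
have [c fc] := lipb_prop f.
have [|fk fkE] := @lipb_ex R X _ _ c (lipschitzM kL (LipP f) kn fc).
  by move=> x; rewrite normrM -[c]mul1r ler_pM//; exact: kn.
have [|fk' fk'E] := @lipb_ex R X _ _ c
    (lipschitzM (lipschitzB (lipschitz_cst 1) kL) (LipP f) kn' fc).
  by move=> x; rewrite normrM -[c]mul1r ler_pM//; exact: kn'.
have -> : T f (fcons w' s) = T fk (fcons w' s) + T fk' (fcons w' s).
  by apply: current_addl => // x; rewrite fkE fk'E -/(k x); ring.
rewrite [X in _ + X]eq0_on_fcons ?addr0; last first.
  move=> x; rewrite fk'E w'E -/(k x) => h; apply: truncate0.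
  rewrite leNgt; apply: contra h => dw.
  rewrite /k min_l ?subrr ?mul0r// mulrC ler_pdivlMr// mul1r ltW//.
rewrite (le_trans (bounds_mass_fcons _ _ w'L))//.
rewrite lee_wpmul2l ?lee_fin ?lip_prod_ge0//.
rewrite lee_wpmul2l ?lee_fin ?mulr_ge0// [leRHS]integral_mkcond.
apply: ge0_le_integral => //.
- exact: measurable_norm_lipb.
- apply/(measurable_restrictT _ _).1.
    exact: measurable_neq0.
  by apply: measurable_funS (measurable_norm_lipb f).
move=> x _; rewrite patchE fkE -/(k x); case: ifPn => [_|].
  by rewrite lee_fin normrM ler_piMl.
by rewrite notin_setE /= => /negP; rewrite negbK => /eqP w0; rewrite /k w0 normr0 mulr0 min_r ?mul0r ?normr0.
Qed.

(** The locality axiom only concerns Lipschitz f, whose set f <> 0 is open, while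
here w vanishes on an arbitrary closed set. The truncations of w vanish on
neighbourhoods of that set and converge to w with bounded Lipschitz constants.
The factor 2 is the loss in the Lipschitz constant of a truncation. *)
Lemma locality f w s L : lipschitz_with (lip_fun w : X -> R^o) L ->
  (`|T f (fcons w s)|%:E <= (lip_prod s)%:E *
    ((2 * L)%:E * \int[nu]_(x in [set x | (w x != 0)%R]) `|f x|%:E))%E.
Proof.
move=> wL; set B := (_ * (_ * _))%E.
have ex n : exists w' : lip X, forall x, w' x = truncate n.+1%:R^-1 (w x).
  have h : lipschitz_map ((fun x => truncate n.+1%:R^-1 (w x)) : X -> R^o).
    by exists (2 * L); exact: lipschitz_truncate.
  by exists (MkLip h).
have [w_ w_E] := choice ex.
have w_L n : lipschitz_with (lip_fun (w_ n) : X -> R^o) (2 * L).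
  rewrite (_ : lip_fun (w_ n) = (fun x => truncate n.+1%:R^-1 (w x))) ?funeqE//.
  exact: lipschitz_truncate.
have le_B n : (`|T f (fcons (w_ n) s)|%:E <= B)%E.
  by apply: (bounds_mass_truncate f s _ wL (w_E n)).
have [_ Tcont _ _] := cT.
have cv : T f (fcons (w_ n) s) @[n --> \oo] --> T f (fcons w s).
  apply: Tcont.
  - move=> i x; case: (unliftP ord0 i) => [j ->|->].
      by rewrite fcons_lift; under eq_fun do rewrite fcons_lift; exact: cvg_cst.
    rewrite fcons0; under eq_fun do rewrite fcons0.
    apply/cvgrPdist_le => e e0; near=> n.
    rewrite distrC w_E (le_trans (truncate_dist _ _))//.
    by apply: ltW; near: n; exact: (near_infty_natSinv_lt (PosNum e0)).
  - exists (2 * L + \sum_i Lip (s i)) => n i; case: (unliftP ord0 i) => [j ->|->].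
      rewrite fcons_lift (bigD1 j)//= addrCA ler_wpDr ?addr_ge0 ?mulr_ge0 ?wL.1//.
      by apply: sumr_ge0 => ? _; exact: Lip_ge0.
    rewrite fcons0 ler_wpDr ?Lip_le//.
    by apply: sumr_ge0 => ? _; exact: Lip_ge0.
have : (0 <= B)%E.
  by rewrite !mule_ge0 ?lee_fin ?lip_prod_ge0 ?mulr_ge0 ?wL.1 ?integral_ge0.
case: B le_B => [b| |] le_B // _; last exact: leey.
have cvn : `|T f (fcons (w_ n) s)| @[n --> \oo] --> `|T f (fcons w s)|.
  exact: cvg_norm.
rewrite lee_fin -(cvg_lim _ cvn)//.
apply: limr_le; first by apply/cvg_ex; eexists; exact: cvn.
by apply: nearW => n; rewrite -lee_fin.
Unshelve. all: by end_near. Qed.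


(** The current only feels the local slope of w. On the set where w agrees with
w_n, the form w may be replaced by w_n by locality, so the least measure
dominating f |-> T(f, w, s) is at most l_n nu there; a countable partition of X
into such sets gives the bound. *)
Lemma local_bound (w : lip X) (w_ : nat -> lip X) (l : nat -> R)
    (g : borel X -> R) s :
  (forall n, lipschitz_with (lip_fun (w_ n) : X -> R^o) (l n)) ->
  measurable_fun setT g -> (forall y, 0 <= g y) ->
  (forall y, exists n, w y = w_ n y /\ l n <= g y) ->
  (`|T (lipb_one X) (fcons w s)|%:E <=
   (lip_prod s)%:E * \int[nu]_y (g y)%:E)%E.
Proof.
move=> w_L mg g0 wg; have [L0 wL] := LipP w.
have l0 n : 0 <= l n := (w_L n).1.
have diff_ex n : exists w' : lip X, forall x, w' x = w x - w_ n x.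
  have h : lipschitz_map ((fun x => w x - w_ n x) : X -> R^o).
    by exists (Lip w + l n); apply: lipschitzB => //; exact: LipP.
  by exists (MkLip h).
have [v vE] := choice diff_ex.
have vL n : lipschitz_with (lip_fun (v n) : X -> R^o) (Lip w + l n).
  rewrite (_ : lip_fun (v n) = (fun x => w x - w_ n x)) ?funeqE//.
  by apply: lipschitzB => //; exact: LipP.
have c0 n : 0 <= 2 * (Lip w + l n) by rewrite mulr_ge0// addr_ge0.
pose D n : set (borel X) := [set x | (v n x != 0)%R].
have mD n : measurable (D n) := measurable_neq0 (v n).
(* T(f, w, s) splits into T(f, w_n, s), bounded by l_n nu, and T(f, w - w_n, s),
   which by locality is bounded by a multiple of nu on the set w <> w_n. *)
pose nu_ n := measure_add (mscale (NngNum (l0 n)) nu)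
  (mscale (NngNum (c0 n)) (mrestr nu (mD n))).
pose lam (_ : unit) f := T f (fcons w s).
have dom n : dominating lam (fun=> lip_prod s) (nu_ n).
  have nuTfin := nuT.1.
  split.
    rewrite [X in (X < _)%E]measure_addE; apply: lte_add_pinfty.
      by rewrite /= /mscale lte_mul_pinfty// ?lee_fin.
    rewrite /= /mscale lte_mul_pinfty// ?lee_fin// /mrestr.
    by apply: le_lt_trans nuTfin; apply: le_measure; rewrite ?inE// setTI.
  move=> [] f; rewrite /lam.
  have mf := measurable_norm_lipb f.
  rewrite ge0_integral_measure_add// !ge0_integral_mscale//.
  rewrite integral_mrestr// (@current_addr f w (w_ n) (v n)); last first.
    by move=> x; rewrite vE addrC subrK.
  rewrite ge0_muleDr ?mule_ge0 ?integral_ge0 ?lee_fin//.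
  rewrite (le_trans _ (leeD (bounds_mass_fcons f s (w_L n)) (locality f s (vL n))))//.
  by rewrite -EFinD lee_fin ler_normD.
have [k [kT kdom] kmin] := least_dominating_measure
  (fun=> lip_prod_ge0 s) (fun (_ : unit) => current_addl cT (fcons w s)) (dom 0%N).
have := kdom tt (lipb_one X); rewrite /lam => /le_trans; apply.
rewrite lee_wpmul2l ?lee_fin ?lip_prod_ge0//.
under eq_integral do rewrite /= normr1.
rewrite integral_cst// mul1e.
pose E n : set (borel X) := (~` D n) `&` [set y | l n <= g y].
have mE n : measurable (E n).
  apply: measurableI; first exact: measurableC.
  rewrite (_ : [set _ | _] = g @^-1` `[l n, +oo[%classic).
    by rewrite -[X in measurable X]setTI; exact: mg.
  by apply/seteqP; split => x /=; rewrite in_itv /= andbT.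
have EU : \bigcup_n E n = setT.
  rewrite -subTset => y _; have [n [wn ln]] := wg y; exists n => //; split => //=.
  by rewrite /D /= vE wn subrr eqxx.
have mS n : measurable (seqDU E n) by apply: measurableD => //; exact: bigsetU_measurable.
rewrite -EU seqDU_bigcup_eq ge0_integral_bigcup//; last 2 first.
- by apply: measurable_funTS; exact/measurable_EFinP.
- by move=> y _; rewrite lee_fin.

rewrite (le_trans (measure_sigma_subadditive _ _ _ (@subset_refl _ _)))//.
  exact: bigcup_measurable.
apply: lee_nneseries => // n _.
have SE : seqDU E n `<=` E n by move=> x [].
rewrite (le_trans (kmin _ (dom n) _ (mS n)))// [leLHS]measure_addE /= /mscale /= /mrestr.
rewrite (_ : seqDU E n `&` D n = set0) ?measure0 ?mule0 ?adde0; last first.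
  by rewrite -subset0 => x [/SE[]].
rewrite /= -integral_cst//; apply: ge0_le_integral => //.
- by move=> x _; rewrite lee_fin.
- by apply: measurable_funTS; exact/measurable_EFinP.
- by move=> x /SE[_ /=]; rewrite lee_fin.
Qed.

End locality.

(** * Positivity of the Hausdorff constant *)

Section powers.
Context {R : realType}.

Lemma powR_invl (x p : R) : 0 < x -> x^-1 `^ p = (x `^ p)^-1.
Proof.
by move=> x0; rewrite -powRN -(powR_inv1 (ltW x0)) -powRrM mulN1r.
Qed.

End powers.

Section gamma_positive.
Context {R : realType}.
Local Notation mu := (@lebesgue_measure R).

(** One term of the exponential series controls every power of smaller exponent. *)
Lemma powR_le_exp (b t : R) (n : nat) : 0 <= b <= n.+1%:R -> 0 < t ->
  t `^ b <= (2 ^+ n.+1 * n.+1`!%:R) * expR (t / 2).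
Proof.
move=> /andP[b0 bn] t0.
apply: (@le_trans _ _ (1 + t ^+ n.+1)).
  have [t1|/ltW t1] := lerP 1 t.
    by rewrite -powR_mulrn ?(ltW t0)// (le_trans (ler_powR t1 bn))// lerDr.
  rewrite ler_wpDr ?exprn_ge0 ?(ltW t0)//.
  have := @ger_powR _ t; rewrite t0 t1 => /(_ isT 0 b b0).
  by rewrite powRr0.
have t20 : 0 <= t / 2 by rewrite divr_ge0// ltW.
have K0 : 0 < 2 ^+ n.+1 * n.+1`!%:R :> R.
  by rewrite mulr_gt0 ?exprn_gt0// ltr0n fact_gt0.
apply: le_trans (ler_wpM2l (ltW K0) (expR_ge1Dxn n t20)).
rewrite mulrDr mulr1 lerD//.
  by rewrite mulr_ege1 ?exprn_ege1 ?ler1n ?fact_gt0.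
rewrite expr_div_n le_eqVlt; apply/orP; left; apply/eqP; field.
by rewrite pnatr_eq0 -lt0n fact_gt0 expf_neq0.
Qed.

(** [Gamma] is the finite part of an extended integral, and would be 0 if that
integral were infinite; so both finiteness and positivity are needed. *)
Lemma Gamma_gt0 (s : R) : 1 <= s -> 0 < Gamma s.
Proof.
move=> s1; pose h (t : R) : R := t `^ (s - 1) * expR (- t).
pose D : set R := `]0, +oo[%classic.
have mD : measurable D by exact: measurable_itv.
have h0 t : 0 <= h t by rewrite /h mulr_ge0 ?powR_ge0// expR_ge0.
have mh : measurable_fun setT (fun t : R => (h t)%:E).
  apply/measurable_EFinP; apply: measurable_funM; first exact: measurable_powR.
  by apply: measurableT_comp => //; exact: measurable_expR.
have s10 : 0 <= s - 1 by rewrite subr_ge0.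
pose n := Num.trunc (s - 1).
have bn : 0 <= s - 1 <= n.+1%:R by rewrite s10 ltW// truncnS_gt.
pose K : R := 2 ^+ n.+1 * n.+1`!%:R.
have K0 : 0 <= K by rewrite mulr_ge0 ?exprn_ge0.
(* t^(s-1) exp(-t) <= K exp(-t/2), which is 2 K times the exponential density of
   rate 1/2. *)
have half : 0 < 2^-1 :> R by [].
have mpdf : measurable_fun setT (fun t : R => (exponential_pdf 2^-1 t)%:E).
  by apply/measurable_EFinP; exact: measurable_exponential_pdf.
have fin : (\int[mu]_(t in D) (h t)%:E < +oo)%E.
  apply: (@le_lt_trans _ _ (\int[mu]_t ((2 * K)%:E * (exponential_pdf 2^-1 t)%:E))%E).
    rewrite [leLHS]integral_mkcond; apply: ge0_le_integral => //.
    - by move=> t _; rewrite patchE; case: ifP => // _; rewrite lee_fin.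
    - apply/(measurable_restrictT _ _).1 => //; exact: (measurable_funTS mh).
    - exact: measurable_funeM.
    move=> t _; rewrite patchE; case: ifPn => [|_]; last first.
      by rewrite -EFinM lee_fin !mulr_ge0// exponential_pdf_ge0// ltW.
    rewrite inE /D /= in_itv /= andbT => t0.
    rewrite -EFinM lee_fin exponential_pdfE ?(ltW t0)// /h.
    rewrite (le_trans (ler_wpM2r (expR_ge0 (- t)) (powR_le_exp bn t0)))//.
    rewrite -/K -mulrA -expRD (_ : t / 2 + - t = - 2^-1 * t); last by field.
    by rewrite le_eqVlt; apply/orP; left; apply/eqP; field.
  rewrite ge0_integralZl_EFin//; last 2 first.
  - by move=> t _; rewrite lee_fin exponential_pdf_ge0// ltW.
  - by rewrite mulr_ge0.
  by rewrite integral_exponential_pdf// mule1 ltry.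
have pos : (0 < \int[mu]_(t in D) (h t)%:E)%E.
  pose J : set R := `[1, 2]%classic.
  have mJ : measurable J by exact: measurable_itv.
  apply: (@lt_le_trans _ _ (\int[mu]_(t in J) (expR (- 2))%:E)%E).
    rewrite integral_cst//= /J lebesgue_measure_itv /= lte_fin.
    rewrite ifT; last lra.
    by rewrite -EFinB -EFinM lte_fin mulr_gt0 ?expR_gt0//; lra.
  apply: (@le_trans _ _ (\int[mu]_(t in J) (h t)%:E)%E).
    apply: ge0_le_integral => //.
    - exact: (measurable_funTS mh).
    move=> t; rewrite /J /= in_itv /= => /andP[t1 t2]; rewrite lee_fin /h.
    rewrite -[leLHS]mul1r ler_pM ?expR_ge0//; last by rewrite ler_expR lerN2.
    by have := ler_powR t1 s10; rewrite powRr0.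
  apply: ge0_subset_integral => //.
  - exact: (measurable_funTS mh).
  - by move=> t _; rewrite lee_fin.
  - move=> t; rewrite /J /D /= !in_itv /= => /andP[t1 _]; rewrite ?andbT; exact: lt_le_trans t1.
by apply: fine_gt0; rewrite pos fin.
Qed.

Lemma hausdorff_const_gt0 (a : R) : 0 <= a -> 0 < hausdorff_const a.
Proof.
move=> a0; rewrite /hausdorff_const !divr_gt0 ?powR_gt0 ?pi_gt0//.
by apply: Gamma_gt0; lra.
Qed.

End gamma_positive.

(** * Covers by balls of a compact set of finite Hausdorff measure *)

Section covers.
Context {R : realType} {X : pmetricType R}.
Implicit Types (A : set X) (a : R).

Lemma hausdorff_gauge_ge0 a (E : set X) : 0 <= a -> (0 <= hausdorff_gauge a E)%E.
Proof.
move=> a0; rewrite /hausdorff_gauge; case: asboolP => // _.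
by rewrite mule_ge0 ?poweR_ge0// lee_fin ltW// hausdorff_const_gt0.
Qed.

(** The bound M is the same at every scale, because every content is at most the
Hausdorff measure. *)
Lemma hausdorff_cover a A : (hausdorff a A < +oo)%E ->
  exists M : R, forall d, 0 < d -> exists E : nat -> set X,
    [/\ A `<=` \bigcup_i E i, forall i, (diam (E i) <= d%:E)%E &
        (\sum_(i <oo) hausdorff_gauge a (E i) <= M%:E)%E].
Proof.
move=> fin; have [M hM] : exists M : R, (hausdorff a A < M%:E)%E.
  case: (hausdorff a A) fin => [r| |] // _; last by exists 0; exact: ltNyr.
  by exists (r + 1); rewrite lte_fin; lra.
exists M => d d0.
have : (hausdorff_content a d A < M%:E)%E.
  by apply: le_lt_trans hM; apply: ereal_sup_ubound; exists d.
by move=> /ereal_inf_lt[_ [E [AE dE] <-] /ltW ?]; exists E.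
Qed.

Lemma diam_ge0 (E : set X) x : E x -> (0 <= diam E)%E.
Proof. by move=> Ex; apply: ereal_sup_ubound; exists x => //; exists x => //; rewrite mdistxx. Qed.

Lemma mdist_le_diam (E : set X) x y : E x -> E y -> ((mdist x y)%:E <= diam E)%E.
Proof. by move=> Ex Ey; apply: ereal_sup_ubound; exists x => //; exists y. Qed.

(** Lets a set be enclosed in an open ball whose radius is strictly larger than
its diameter, at a small cost in the a-th power; diameter 0 and exponent 0 are
allowed. *)
Lemma radius_exists a (d t e : R) : 0 <= a -> 0 <= d -> d < t -> 0 < e ->
  exists r, d < r <= t /\ r `^ a <= d `^ a + e.
Proof.
move=> a0 d0 dt e0; have [->|an0] := eqVneq a 0.
  by exists t; rewrite dt lexx !powRr0; split => //; lra.
have {a0 an0}a0 : 0 < a by rewrite lt_neqAle eq_sym an0.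
pose q := (d `^ a + e) `^ a^-1.
have qa : q `^ a = d `^ a + e.
  by rewrite /q -powRrM mulVf ?gt_eqF// powRr1// addr_ge0 ?powR_ge0// ltW.
have dq : d < q.
  rewrite ltNge; apply/negP => qd.
  have := ge0_ler_powR (ltW a0) (powR_ge0 _ _ : q \in Num.nneg) (d0 : d \in Num.nneg) qd.
  by rewrite qa; lra.
exists (Num.min q t); rewrite lt_min dq dt ge_min lexx orbT; split => //.
rewrite -qa ge0_ler_powR ?(ltW a0)// ?nnegrE ?le_min ?powR_ge0 ?ge_min ?lexx//=.
by rewrite (le_trans d0 (ltW dt)).
Qed.

Lemma open_mball (x : X) r : open (ball x r).
Proof.
rewrite ballEmdist (_ : [set _ | _] = mdist x @^-1` [set y | y < r])//.
apply: open_comp; last exact: open_lt.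
by move=> y _; exact: lipschitz_continuous (lipschitz_dist x) y.
Qed.

(** Pairs are (centre, radius). *)
Definition fine_cover A (s : seq (X * R)) (d : R) :=
  (forall b, b \in s -> A b.1 /\ 0 < b.2 < d) /\
  (forall x, A x -> exists2 b, b \in s & mdist b.1 x < b.2).

(** Enclose the sets of an efficient cover in open balls centred on A, with
errors 2^-i that sum to at most 2, and extract a finite subcover. *)
Lemma compact_ball_cover a A : 0 <= a -> compact A -> (hausdorff a A < +oo)%E ->
  exists M : R, forall d, 0 < d -> exists2 s, fine_cover A s d &
    \sum_(b <- s) b.2 `^ a <= M.
Proof.
move=> a0 cA /hausdorff_cover[M0 hM0].
pose c := hausdorff_const a; have c0 : 0 < c := hausdorff_const_gt0 a0.
exists (M0 / c + 2) => d d0.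
have d20 : 0 < d / 2 by lra.
have [E [AE dE sE]] := hM0 _ d20.
have ex i : exists xr : X * R, E i `&` A !=set0 ->
    [/\ (E i `&` A) xr.1, 0 < xr.2 < d, E i `<=` ball xr.1 xr.2 &
      ((xr.2 `^ a)%:E <= (c^-1)%:E * hausdorff_gauge a (E i) + (2^-1 ^+ i)%:E)%E].
  have [[x [Ex Ax]]|] := pselect (E i `&` A !=set0); last by exists point.
  have := dE i; have := diam_ge0 Ex; case diamE : (diam (E i)) => [t| |] //.
  rewrite !lee_fin => t0 td.
  have ht : t < d * (3 / 4) by lra.
  have ei : 0 < 2^-1 ^+ i :> R by rewrite exprn_gt0// invr_gt0.
  have [r [/andP[tr rd] ra]] := radius_exists a0 t0 ht ei.
  exists (x, r) => _; split => //=.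
  - by apply/andP; split; lra.
  - move=> y Ey; rewrite ballEmdist /=.
    by have := mdist_le_diam Ex Ey; rewrite diamE lee_fin => /le_lt_trans; apply.
  rewrite /hausdorff_gauge; case: asboolP => [E0|_]; first by rewrite E0 in Ex.
  rewrite diamE poweR_EFin -!EFinM -EFinD lee_fin mulrA mulVf ?gt_eqF//.
  by rewrite mul1r.
have [xr xrP] := choice ex.
pose P i := `[< E i `&` A !=set0 >].
pose f i := if P i then ball (xr i).1 (xr i).2 else set0.
have := cA; rewrite compact_cover => /(_ nat setT f)[].
- by move=> i _; rewrite /f; case: ifP => _; [exact: open_mball|exact: open0].
- move=> x Ax; have [i _ Eix] := AE x Ax; exists i => //; rewrite /f.
  have EA : E i `&` A !=set0 by exists x.
  by rewrite /P asboolT//; have [_ _ EB _] := xrP i EA; exact: EB.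
move=> D' _ AD'.
have [N hN] : exists N, forall i, i \in D' -> (i < N)%N.
  exists (\max_(i <- enum_fset D') i).+1 => i iD'; rewrite ltnS.
  exact: (@leq_bigmax_seq _ (enum_fset D') predT id i).
exists [seq xr i | i <- iota 0 N & P i].
  split.
    move=> b /mapP[i]; rewrite mem_filter => /andP[/asboolP EA _] ->.
    by have [[_ ?] ? _ _] := xrP i EA.
  move=> x /AD'[i /= iD']; rewrite /f; case: ifP => // Pi.
  rewrite ballEmdist /= => xi; exists (xr i) => //; apply/mapP; exists i => //.
  by rewrite mem_filter Pi mem_iota /= add0n hN.
rewrite big_map big_filter (_ : iota 0 N = index_iota 0 N); last first.
  by rewrite /index_iota subn0.
have ci0 : (0 <= (c^-1)%:E)%E by rewrite lee_fin invr_ge0 ltW.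
have g0 i : (0 <= hausdorff_gauge a (E i))%E by exact: hausdorff_gauge_ge0.
have h0 i : (0 <= (2^-1 ^+ i : R)%:E)%E by rewrite lee_fin exprn_ge0// invr_ge0.
rewrite -lee_fin -sumEFin.
apply: (@le_trans _ _ (\sum_(0 <= i < N)
    ((c^-1)%:E * hausdorff_gauge a (E i) + (2^-1 ^+ i)%:E)))%E.
  rewrite big_mkcond /=; apply: lee_sum => i _; case: ifPn => [/asboolP Pi|_].
    by have [] := xrP i Pi.
  by rewrite adde_ge0// mule_ge0.
rewrite big_split /= EFinD leeD//.
  rewrite -ge0_sume_distrr// mulrC EFinM lee_wpmul2l//.
  by apply: le_trans sE; apply: nneseries_lim_ge.
rewrite sumEFin lee_fin.
suff -> : \sum_(0 <= i < N) 2^-1 ^+ i = 2 - 2 * 2^-1 ^+ N :> R.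
  by rewrite gerBl mulr_ge0// exprn_ge0// invr_ge0.
elim: (N) => [|n ih]; first by rewrite big_geq// expr0; ring.
by rewrite big_nat_recr //= ih exprS; field.
Qed.

End covers.

(** * Cutoff functions of a cover and their slopes *)

Section cutoffs.
Context {R : realType} {X : pmetricType R}.
Implicit Types (b : X * R) (s : seq (X * R)).

(** Equal to 1 up to distance twice the radius and to 0 from three times the
radius on. *)
Definition bump b (x : X) : R := Num.max (Num.min (3 - b.2^-1 * mdist b.1 x) 1) 0.

Fixpoint cutoff s (x : X) : R :=
  if s is b :: s' then Num.max (bump b x) (cutoff s' x) else 0.

(** For a list sorted by radius, the largest inverse radius among the enlarged
balls that contain x; this bounds the slope of [cutoff s] at x. *)
Fixpoint slope s (x : X) : R :=
  if s is b :: s' then if mdist b.1 x <= 3 * b.2 then b.2^-1 else slope s' x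
  else 0.

(** For a list sorted by radius, a Lipschitz constant of [cutoff s]. *)
Definition max_slope s : R := if s is b :: _ then b.2^-1 else 0.

Definition core s : set X := [set x | exists2 b, b \in s & mdist b.1 x <= 2 * b.2].
Definition halo s : set X := [set x | exists2 b, b \in s & mdist b.1 x <= 3 * b.2].

Definition positive_radii s := forall b, b \in s -> 0 < b.2.

Lemma positive_radii_cons b s : positive_radii (b :: s) -> 0 < b.2 /\ positive_radii s.
Proof.
by move=> h; split; [apply: h; rewrite mem_head|move=> c cs; apply: h; rewrite inE cs orbT].
Qed.

Definition by_radius : rel (X * R) := fun b c => b.2 <= c.2.

Lemma core_halo s : positive_radii s -> core s `<=` halo s.
Proof.
move=> s0 x [b bs bx]; exists b => //.
by have := s0 b bs; move: bx; set t := mdist _ _; move=> ? ?; lra.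
Qed.

Lemma bump_ge0 b x : 0 <= bump b x. Proof. by rewrite /bump le_max lexx orbT. Qed.

Lemma bump_le1 b x : bump b x <= 1.
Proof. by rewrite /bump ge_max ler01 ge_min lexx orbT. Qed.

Lemma bump1 b x : 0 < b.2 -> mdist b.1 x <= 2 * b.2 -> bump b x = 1.
Proof.
move=> b0 bx; have : b.2^-1 * mdist b.1 x <= 2 by rewrite mulrC ler_pdivrMr.
by move=> ?; rewrite /bump min_r ?max_l//; lra.
Qed.

Lemma bump0 b x : 0 < b.2 -> 3 * b.2 < mdist b.1 x -> bump b x = 0.
Proof.
move=> b0 bx; have : 3 < b.2^-1 * mdist b.1 x by rewrite mulrC ltr_pdivlMr.
by move=> ?; rewrite /bump min_l ?max_r//; lra.
Qed.

Lemma lipschitz_bump b : 0 < b.2 -> lipschitz_with (bump b : X -> R^o) b.2^-1.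
Proof.
move=> b0; have b0' : 0 <= b.2^-1 by rewrite invr_ge0 ltW.
have := lipschitz_max (lipschitz_min (lipschitzB (lipschitz_cst 3)
  (lipschitzZ b0' (lipschitz_dist b.1))) (lipschitz_cst 1)) (lipschitz_cst 0).
by rewrite add0r mulr1 !max_l.
Qed.

Lemma cutoff_ge0 s x : 0 <= cutoff s x.
Proof. by elim: s => //= b s ih; rewrite le_max bump_ge0. Qed.

Lemma cutoff_le1 s x : cutoff s x <= 1.
Proof. by elim: s => //= b s ih; rewrite ge_max bump_le1. Qed.

Lemma cutoff_core s x : positive_radii s -> core s x -> cutoff s x = 1.
Proof.
move=> + [c cs cx]; elim: s cs => //= b s ih + /positive_radii_cons[b0 s0].
rewrite inE => /orP[/eqP cb|/ih -> //].
  by move: cx; rewrite cb => cx; rewrite bump1 ?max_l ?cutoff_le1.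
by rewrite max_r ?bump_le1.
Qed.

Lemma cutoff_out s x : positive_radii s -> ~ halo s x -> cutoff s x = 0.
Proof.
elim: s => //= b s ih /positive_radii_cons[b0 s0] bx.
rewrite ih//; last by move=> [c cs cx]; apply: bx; exists c => //; rewrite inE cs orbT.
rewrite bump0 ?maxxx// ltNge; apply/negP => h; apply: bx; exists b => //.
exact: mem_head.
Qed.

Lemma lipschitz_cutoff s : positive_radii s -> sorted by_radius s ->
  lipschitz_with (cutoff s : X -> R^o) (max_slope s).
Proof.
elim: s => [_ _|b s ih /positive_radii_cons[b0 s0] bs]; first exact: lipschitz_cst.
have := lipschitz_max (lipschitz_bump b0) (ih s0 (path_sorted bs)).
congr (lipschitz_with _ _); rewrite max_l//.
case: s bs s0 {ih} => /= [_ _|c s /andP[bc _] /positive_radii_cons[c0 _]].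
  by rewrite invr_ge0 ltW.
by rewrite lef_pV2.
Qed.

(** The balls that precede the first one reaching x contribute 0 at x. In a list
sorted by radius they are the smallest, so dropping them lowers the Lipschitz
constant. *)
Lemma cutoff_drop s x : positive_radii s -> exists n,
  cutoff s x = cutoff (drop n s) x /\ max_slope (drop n s) <= slope s x.
Proof.
elim: s => [_|b s ih /positive_radii_cons[b0 s0]]; first by exists 0%N.
rewrite /=; case: lerP => bx; first by exists 0%N.
have [n [nE nle]] := ih s0; exists n.+1; rewrite bump0// -nE; split => //.
by rewrite max_r// cutoff_ge0.
Qed.

Lemma slope_ge0 s x : positive_radii s -> 0 <= slope s x.
Proof.
elim: s => //= b s ih /positive_radii_cons[b0 s0]; case: ifP => _; last exact: ih.
by rewrite invr_ge0 ltW.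
Qed.

Lemma slope_powR_le s p x : 0 < p -> positive_radii s ->
  slope s x `^ p <= \sum_(b <- s) b.2^-1 `^ p * \1_(cball b.1 (3 * b.2)) x.
Proof.
move=> p0; elim: s => [_|b s ih /positive_radii_cons[b0 s0]] /=.
  by rewrite big_nil powR0 ?gt_eqF.
rewrite big_cons indicE; case: ifPn => bx.
  rewrite mem_set//= mulr1 ler_wpDr// sumr_ge0// => c _.
  by rewrite mulr_ge0 ?powR_ge0.
by rewrite memNset ?mulr0 ?add0r ?ih//; exact/negP.
Qed.

Lemma measurable_cball (x : X) r : measurable (cball x r : set (borel X)).
Proof.
apply: measurable_closed; rewrite /cball.
rewrite (_ : [set _ | _] = mdist x @^-1` [set y | y <= r])//.
apply: closed_comp; last exact: closed_le.
by move=> y _; exact: lipschitz_continuous (lipschitz_dist x) y.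
Qed.

Lemma measurable_balls (k : R) s : measurable
  ([set x | exists2 b, b \in s & mdist b.1 x <= k * b.2] : set (borel X)).
Proof.
elim: s => [|b s ih].
  by rewrite (_ : [set _ | _] = set0)// -subset0 => x [b].
rewrite (_ : [set _ | _] = (cball b.1 (k * b.2) : set (borel X)) `|`
   [set x | exists2 b, b \in s & mdist b.1 x <= k * b.2]).
  by apply: measurableU => //; exact: measurable_cball.
apply/seteqP; split => x.
  move=> [c]; rewrite inE => /orP[/eqP ->|cs] cx; first by left.
  by right; exists c.
move=> [bx|[c cs cx]]; first by exists b => //; exact: mem_head.
by exists c => //; rewrite inE cs orbT.
Qed.

Lemma measurable_core s : measurable (core s : set (borel X)).
Proof. exact: measurable_balls. Qed.

Lemma measurable_halo s : measurable (halo s : set (borel X)).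
Proof. exact: measurable_balls. Qed.

Lemma measurable_slope s : measurable_fun setT (slope s : borel X -> R).
Proof.
elim: s => [|b s ih] /=; first exact: measurable_cst.
apply: measurable_fun_ifT => //.
apply: measurable_fun_ler => //.
by apply: measurable_continuous; exact: lipschitz_continuous (lipschitz_dist b.1).
Qed.

Definition ring_slope s (x : X) : R := slope s x * \1_(~` core s) x.

Lemma ring_slope_ge0 s x : positive_radii s -> 0 <= ring_slope s x.
Proof. by move=> s0; rewrite mulr_ge0 ?slope_ge0. Qed.

Lemma measurable_ring_slope s : measurable_fun setT (ring_slope s : borel X -> R).
Proof.
apply: measurable_funM; first exact: measurable_slope.
by apply: measurable_indic; apply: measurableC; exact: measurable_core.
Qed.

Lemma slope_out s x : ~ halo s x -> slope s x = 0.
Proof.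
elim: s => //= b s ih bx; case: ifPn => [h|_].
  by exfalso; apply: bx; exists b => //; exact: mem_head.
by apply: ih => -[c cs cx]; apply: bx; exists c => //; rewrite inE cs orbT.
Qed.

Lemma ring_slope_neq0 s x : ring_slope s x != 0 -> halo s x /\ ~ core s x.
Proof.
move=> h; split.
  by apply: contrapT => /slope_out sx; move: h; rewrite /ring_slope sx mul0r eqxx.
by move=> cx; move: h; rewrite /ring_slope indicE memNset ?mulr0 ?eqxx//= => /(_ cx).
Qed.

(** Each ball contributes at most r^-p C (3 r)^Q = C 3^Q r^(Q-p). *)
Lemma integral_ring_slope (mu : {measure set (borel X) -> \bar R}) (p Q C M : R) s :
  0 < p -> 0 <= C -> positive_radii s ->
  (forall x r, 0 < r -> (mu (cball x r) <= (C * r `^ Q)%:E)%E) ->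
  \sum_(b <- s) b.2 `^ (Q - p) <= M ->
  (\int[mu]_x (ring_slope s x `^ p)%:E <= (C * 3 `^ Q * M)%:E)%E.
Proof.
move=> p0 C0 s0 muC sM.
pose h b (x : borel X) : \bar R := (b.2^-1 `^ p * \1_(cball b.1 (3 * b.2)) x)%:E.
have mh b : measurable_fun setT (h b).
  apply/measurable_EFinP; apply: measurable_funM => //.
  by apply: measurable_indic; exact: measurable_cball.
have h0 b x : (0 <= h b x)%E by rewrite lee_fin mulr_ge0 ?powR_ge0.
apply: (@le_trans _ _ (\int[mu]_x \sum_(b <- s) h b x))%E.
  apply: ge0_le_integral => //.
  - by move=> x _; rewrite lee_fin powR_ge0.
  - apply/measurable_EFinP; apply: (measurableT_comp (measurable_powR p)).
    exact: measurable_ring_slope.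
  - exact: emeasurable_sum.
  move=> x _; rewrite sumEFin lee_fin (le_trans _ (slope_powR_le x p0 s0))//.
  rewrite /ring_slope indicE; case: (x \in _); rewrite /= ?mulr1// mulr0 powR0 ?gt_eqF//.
  exact: powR_ge0.
rewrite ge0_integral_sum//.
apply: (@le_trans _ _ (\sum_(b <- s) (C * 3 `^ Q * b.2 `^ (Q - p))%:E))%E; last first.
  by rewrite sumEFin lee_fin -mulr_sumr ler_wpM2l// mulr_ge0 ?powR_ge0.
rewrite big_seq [leRHS]big_seq; apply: lee_sum => b bs; have b0 := s0 b bs.
rewrite /h; under eq_integral do rewrite EFinM.
rewrite ge0_integralZl_EFin ?powR_ge0//; last first.
  by apply/measurable_EFinP; apply: measurable_indic; exact: measurable_cball.
rewrite integral_indic ?setIT//; last exact: measurable_cball.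
rewrite (le_trans (lee_wpmul2l _ (muC _ _ _))) ?lee_fin ?powR_ge0 ?mulr_gt0//.
rewrite powR_invl//.
rewrite powRM ?(ltW b0)// powRB; last by rewrite (gt_eqF b0) implybT.
by rewrite le_eqVlt; apply/orP; left; apply/eqP; ring.
Qed.

End cutoffs.

(** * Measures concentrated on separable sets *)

Section concentration.
Context {R : realType} {X : pmetricType R}.

(** The points of a separable set are covered by countably many balls with centre
in a countable dense set and radius 1 / (n + 1), keeping only null balls. *)
Lemma null_of_locally_null (nu : {measure set (borel X) -> \bar R})
    (K : countType) (z : K -> X) (N : set (borel X)) :
  nu (~` closure (range z) : set (borel X)) = 0%E -> measurable N ->
  (forall x, N x -> exists2 r, 0 < r & nu (cball x r) = 0%E) -> nu N = 0%E.
Proof.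
move=> nuz mN Nloc.
have mcl : measurable (~` closure (range z) : set (borel X)).
  by apply: measurableC; apply: measurable_closed; exact: closed_closure.
pose F (j : nat) : set (borel X) := 
  if (choice.unpickle j : option (K * nat)) is Some (k, n) then
    if `[< nu (cball (z k) n.+1%:R^-1) = 0%E >] then cball (z k) n.+1%:R^-1 else set0
  else set0.
have mF j : measurable (F j).
  rewrite /F; case: choice.unpickle => [[k n]|] //.
  by case: asboolP => // _; exact: measurable_cball.
have F0 j : nu (F j) = 0%E.
  rewrite /F; case: choice.unpickle => [[k n]|]; last exact: measure0.
  by case: asboolP => // _; rewrite measure0.
have mU : measurable (\bigcup_j F j) by apply: bigcup_measurable => j _; exact: mF.
have UF0 : nu (\bigcup_j F j) = 0%E.
  apply: (measure_negligible mU); apply: negligible_bigcup => j.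
  by exists (F j); split.
have NF : N `<=` ~` closure (range z) `|` \bigcup_j F j.
  move=> x Nx; have [cx|ncx] := pselect (closure (range z) x); last by left.
  right; have [r r0 nur] := Nloc x Nx.
  have [n nr] : exists n : nat, n.+1%:R^-1 < r / 2.
    exists (Num.trunc (r / 2)^-1); rewrite invf_plt ?posrE ?divr_gt0 ?ltr0n//.
    exact: truncnS_gt.
  have n0 : 0 < n.+1%:R^-1 :> R by rewrite invr_gt0 ltr0n.
  have [_ [[k _ <-]]] := cx _ (nbhsx_ballx (x : X) _ n0).
  rewrite ballEmdist /= => xzk.
  exists (choice.pickle (k, n)) => //; rewrite /F choice.pickleK asboolT.
    by rewrite /cball /= metric_sym ltW.
  apply/eqP; rewrite eq_le measure_ge0 andbT -nur le_measure ?inE//.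
  - exact: measurable_cball.
  - exact: measurable_cball.
  move=> y; rewrite /cball /= => zy; rewrite (le_trans (metric_triangle x (z k) y))//.
  by rewrite (le_trans (lerD (ltW xzk) zy))// (splitr r) lerD// ltW.
apply/eqP; rewrite eq_le measure_ge0 andbT.
rewrite (@le_trans _ _ (nu (~` closure (range z) `|` \bigcup_j F j)))//.
  by rewrite le_measure ?inE//; exact: measurableU.
by rewrite (le_trans (measureU2 _ _ _))// [X in (X + _)%E]nuz [X in (_ + X)%E]UF0 adde0.
Qed.

Lemma hausdorff_ge0 (a : R) (S : set X) : 0 <= a -> (0 <= hausdorff a S)%E.
Proof.
move=> a0; apply: (@le_trans _ _ (hausdorff_content a 1 S)); last first.
  apply: ereal_sup_ubound; exists 1 => //=; exact: ltr01.
apply: le_ereal_inf_tmp => _ [E _ <-]; apply: nneseries_ge0 => i _ _.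
exact: hausdorff_gauge_ge0.
Qed.

Lemma le_hausdorff (a : R) (S S' : set X) : S `<=` S' ->
  (hausdorff a S <= hausdorff a S')%E.
Proof.
move=> SS; apply: ge_ereal_sup => _ [d d0 <-].
apply: (@le_trans _ _ (hausdorff_content a d S')); last first.
  by apply: ereal_sup_ubound; exists d.
apply: le_ereal_inf => _ [E [SE dE] <-]; exists E => //; split => //.
exact: subset_trans SE.
Qed.

Definition separably_concentrated (nu : {measure set (borel X) -> \bar R}) :=
  exists (K : countType) (z : K -> X),
    nu (~` closure (range z) : set (borel X)) = 0%E.

(** The atoms may be repeated, so their masses may cancel; the sum of the
|theta_i| times Dirac masses still bounds the mass of T. *)
Lemma atomic_concentrated (T : functional X 0) : integer_rectifiable T ->
  separably_concentrated (mass T).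
Proof.
move=> [cT [k [theta [a [_ TE]]]]].
exists ('I_k : countType), a.
(* The atoms are reindexed by nat because [msum] adds a sequence of measures. *)
pose c (n : nat) : R := if insub n is Some i then `|(theta i)%:~R| else 0.
pose pt (n : nat) : X := if insub n is Some i then a i else point.
have c0 n : 0 <= c n by rewrite /c; case: insub.
pose nu := msum (fun n => mscale (NngNum (c0 n)) (dirac (pt n : borel X))) k.
have cE (i : 'I_k) : c i = `|(theta i)%:~R| by rewrite /c valK.
have ptE (i : 'I_k) : pt i = a i by rewrite /pt valK.
have nuE (B : set (borel X)) : nu B = (\sum_(i < k) (c i)%:E * \d_(pt i : borel X) B)%E by [].
have nuT : bounds_mass T nu.
  split.
    rewrite [X in (X < _)%E]nuE; apply: lte_sum_pinfty => i _.
    by rewrite diracE -EFinM ltry.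
  move=> s f; rewrite /lip_prod big_ord0 mul1e TE.
  rewrite ge0_integral_measure_sum//; last exact: measurable_norm_lipb.
  rewrite (@le_trans _ _ (\sum_(i < k) (`|(theta i)%:~R * f (a i)|)%:E)%E)//.
    by rewrite sumEFin lee_fin ler_norm_sum.
  apply: lee_sum => i _.
  rewrite ge0_integral_mscale//; last exact: measurable_norm_lipb.
  rewrite integral_dirac//; last exact: measurable_norm_lipb.
  by rewrite diracT mul1e ptE /= -EFinM cE normrM.
have mcl : measurable (~` closure (range a) : set (borel X)).
  by apply: measurableC; apply: measurable_closed; exact: closed_closure.
have [_ massmin] := current_mass cT.
apply/eqP; rewrite eq_le measure_ge0 andbT (le_trans (massmin _ nuT _ mcl))//.
rewrite [leLHS]nuE big1// => i _; rewrite diracE ptE memNset ?mule0//.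
by apply; apply: subset_closure; exists i.
Qed.

(** Points of R^m with the same integer parts of (n + 1) x_j are at distance at
most sqrt m / (n + 1); choosing one point of A in each nonempty cell, for all n,
gives a countable dense subset. *)
Lemma lipschitz_image_separable m (A : set (eucl R m)) (g : eucl R m -> X) L :
  (forall x y, A x -> A y -> mdist (g x) (g y) <= L * mdist x y) ->
  exists z : nat * {ffun 'I_m -> int} -> X, g @` A `<=` closure (range z).
Proof.
move=> gL.
(* The cell of x in the grid of mesh 1 / (n + 1). *)
pose code n (x : eucl R m) := [ffun j => Num.floor (n.+1%:R * x ord0 j)].
pose z (nc : nat * {ffun 'I_m -> int}) : X :=
  xget point (g @` [set x | A x /\ code nc.1 x = nc.2]).
exists z => _ [x Ax <-] U /nbhs_ballP[e /= e0 eU].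
pose M := `|L| * Num.sqrt m%:R.
have M0 : 0 <= M by rewrite mulr_ge0 ?sqrtr_ge0.
have [n nM] : exists n : nat, M * n.+1%:R^-1 < e.
  exists (Num.trunc (M / e)); rewrite ltr_pdivrMr ?ltr0n// mulrC -ltr_pdivrMr//.
  exact: truncnS_gt.
exists (z (n, code n x)); split; first by exists (n, code n x).
apply: eU; rewrite ballEmdist /=.
have : exists y, (g @` [set y | A y /\ code n y = code n x]) y by exists (g x), x.
move=> /(xgetPex point); rewrite /z /=.
set w := xget _ _ => -[y [Ay cyx] <-].
rewrite (le_lt_trans (gL _ _ Ax Ay))// (le_lt_trans _ nM)//.
have dxy : mdist x y <= Num.sqrt m%:R * n.+1%:R^-1.
  have n0 : 0 <= n.+1%:R^-1 :> R by rewrite invr_ge0.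
  rewrite -[leRHS]ger0_norm ?mulr_ge0 ?sqrtr_ge0// -sqrtr_sqr ler_wsqrtr//.
  rewrite exprMn sqr_sqrtr//.
  rewrite (@le_trans _ _ (\sum_(i < m) n.+1%:R^-1 ^+ 2))//; last first.
    by rewrite sumr_const card_ord mulr_natl.
  apply: ler_sum => i _.
  have /ffunP/(_ i) := cyx; rewrite !ffunE => fyx.
  have /andP[x1 x2] := floor_itv (n.+1%:R * x ord0 i).
  have /andP[y1 y2] := floor_itv (n.+1%:R * y ord0 i).
  rewrite -[leLHS]real_normK ?num_real// lerXn2r// ?nnegrE// ler_norml.
  have n1 : 0 < n.+1%:R :> R by rewrite ltr0n.
  have xy1 : n.+1%:R * x ord0 i - n.+1%:R * y ord0 i <= 1.
    by move: x2 y1; rewrite fyx intrD; lra.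
  have xy2 : n.+1%:R * y ord0 i - n.+1%:R * x ord0 i <= 1.
    by move: y2 x1; rewrite fyx intrD; lra.
  have key (u v : R) : n.+1%:R * u - n.+1%:R * v <= 1 -> u - v <= n.+1%:R^-1.
    by move=> uv; rewrite -(ler_pM2l n1) mulrBr mulfV ?gt_eqF.
  by rewrite lerNl opprB !key.
by rewrite (le_trans (ler_wpM2r _ (ler_norm L))) ?mdist_ge0// /M -mulrA ler_wpM2l.
Qed.

End concentration.

Section integral_concentration.
Context {R : realType} {X : pmetricType R}.

(** The closure D of the Lipschitz images is separable. Removing from ~D a Borel
null set that contains the complement of the rectifiable set leaves a Borel set
that is negligible for H^m, hence for the mass of T. *)
Lemma rectifiable_concentrated m (T : functional X m.+1) : integer_rectifiable T ->
  separably_concentrated (mass T).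
Proof.
move=> [cT [S [[A [g [gL HS]]] [N [mN N0 SN]]]] Tac _].
have ex i : exists z : nat * {ffun 'I_m.+1 -> int} -> X, g i @` A i `<=` closure (range z).
  by have [L /lipschitz_image_separable] := gL i.
have [z zP] := choice ex.
exists (nat * (nat * {ffun 'I_m.+1 -> int}) : countType)%type, (fun k => z k.1 k.2).
set D := closure _.
have mD : measurable (~` D : set (borel X)).
  by apply: measurableC; apply: measurable_closed; exact: closed_closure.
have gD : \bigcup_i (g i @` A i) `<=` D.
  move=> x [i _ /zP]; apply: closureS => _ [k _ <-]; by exists (i, k).
have ND0 : mass T (~` D `\` N : set (borel X)) = 0%E.
  apply: Tac; first exact: measurableD.
  apply/eqP; rewrite eq_le hausdorff_ge0// andbT -HS; apply: le_hausdorff.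
  move=> x [Dx Nx]; split; first by apply: contrapT => Sx; apply/Nx/SN.
  by move=> gx; apply/Dx/gD.
apply/eqP; rewrite eq_le measure_ge0 andbT.
rewrite (@le_trans _ _ (mass T ((~` D `\` N) `|` N)))//.
  rewrite le_measure ?inE//; first by apply: measurableU => //; exact: measurableD.
  by move=> x Dx; have [Nx|Nx] := pselect (N x); [right|left].
rewrite (le_trans (measureU2 _ _ _))//; first exact: measurableD.
by rewrite [X in (X + _)%E]ND0 [X in (_ + X)%E]N0 adde0.
Qed.

Lemma integral_concentrated m (T : functional X m) : integral_current T ->
  separably_concentrated (mass T).
Proof.
by move=> [+ _]; case: m T => [|m] T; [exact: atomic_concentrated|exact: rectifiable_concentrated].
Qed.

Lemma integral_is_current m (T : functional X m) : integral_current T -> is_current T.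
Proof. by case: m T => [|m] T [_]; [|case]. Qed.

Lemma mass_outside_spt m (T : functional X m) (A : set X) (N : set (borel X)) :
  separably_concentrated (mass T) -> spt T `<=` A -> measurable N ->
  N `<=` ~` A -> mass T N = 0%E.
Proof.
move=> [K [z zT]] TA mN NA; apply: (null_of_locally_null zT mN) => x Nx.
have : ~ spt T x by move=> /TA; exact: NA.
move=> /existsNP[r /not_implyP[r0 nr]]; exists r => //.
by apply/eqP; rewrite eq_le measure_ge0 andbT leNgt; apply/negP.
Qed.

End integral_concentration.

(** * Lower bound for the fillings of a cycle *)

Section filling_estimate.
Context {R : realType} {X : pmetricType R} {m : nat}.
Variables (S : functional X m.+1) (T : functional X m).
Hypotheses (cS : is_current S) (cT : is_current T) (ST : boundary S = T).

Lemma null_integral_lipb (f : lipb X) (N : set (borel X)) :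
  measurable N -> mass T N = 0%E -> (forall x, f x != 0 -> N x) ->
  forall pi, T f pi = 0.
Proof.
move=> mN TN fN pi; have [[_ /(_ pi f) h] _] := current_mass cT.
suff I0 : (\int[mass T]_x `|f x|%:E <= 0)%E.
  apply/eqP; rewrite -normr_le0 -lee_fin (le_trans h)//.
  by rewrite mule_ge0_le0// lee_fin lip_prod_ge0.
have [c fc] := lipb_prop f.
apply: (@le_trans _ _ (\int[mass T]_x (c%:E * (\1_N x)%:E))%E).
  apply: ge0_le_integral => //.
  - exact: measurable_norm_lipb.
  - by apply: measurable_funeM; apply/measurable_EFinP; exact: measurable_indic.
  move=> x _; rewrite -EFinM lee_fin indicE; case: (boolP (x \in N)) => xN.
    by rewrite mulr1.
  rewrite mulr0 normr_le0; apply: contraNT xN => /fN Nx; exact: mem_set.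
have c0 : 0 <= c := le_trans (normr_ge0 _) (fc point).
rewrite ge0_integralZl_EFin//; last by apply/measurable_EFinP; exact: measurable_indic.
by rewrite integral_indic// setIT [X in (_ * X)%E]TN mule0.
Qed.

(** With u = [cutoff s], T(f, pi) = T(u f, pi) = S(1, u f, pi), and [local_bound]
applies to the form u f. It agrees with f on the core, with 0 off the halo, and
elsewhere with the product of f and the cutoff of a sublist. *)
Lemma filling_estimate (s : seq (X * R)) (f : lipb X) (pi : 'I_m -> lip X) (c : R) :
  positive_radii s -> sorted by_radius s ->
  mass T (~` core s : set (borel X)) = 0%E -> (forall x, `|f x| <= c) ->
  (`|T f pi|%:E <= (lip_prod pi)%:E *
    (c%:E * \int[mass S]_x (ring_slope s x)%:E
     + (Lip f)%:E * mass S (halo s : set (borel X))))%E.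
Proof.
move=> s0 srt Tcore fc.
have c0 : 0 <= c := le_trans (normr_ge0 _) (fc point).
have c1 (t : seq (X * R)) (x : X) : `|cutoff t x| <= 1 by rewrite ger0_norm ?cutoff_ge0// cutoff_le1.
have drop_pos n : positive_radii (drop n s).
  by move=> b /mem_drop; exact: s0.
have drop_srt n : sorted by_radius (drop n s) by exact: drop_sorted.
(* By the product rule each [cutoff (drop n s) * f] has Lipschitz constant at most
   Lip f + c * max_slope (drop n s). *)
have LM n := lipschitzM (lipschitz_cutoff (drop_pos n) (drop_srt n)) (LipP f) (c1 (drop n s)) fc.
have [|w wE] := @lipb_ex R X _ _ c (LM 0%N).
  by move=> x; rewrite normrM -[c]mul1r ler_pM//; exact: c1.
rewrite drop0 in wE.
have := lipschitzB (LipP f) (LipP w) => vL.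
have [|v vE] := @lipb_ex R X _ _ (c + c) vL.
  move=> x; rewrite (le_trans (ler_normB _ _))// lerD//.
  by rewrite wE normrM -[c]mul1r ler_pM//; exact: c1.
have TE : T f pi = T w pi.
  rewrite (@current_addl _ _ _ T cT pi w v f); last by move=> x; rewrite vE addrC subrK.
  rewrite [X in _ + X](@null_integral_lipb v _ _ Tcore) ?addr0//.
    by apply: measurableC; exact: measurable_core.
  move=> x; rewrite vE wE => vx cx; move: vx.
  by rewrite cutoff_core// mul1r subrr eqxx.
have lex (g : X -> R) L : lipschitz_with (g : X -> R^o) L ->
    exists w' : lip X, lip_fun w' = g.
  move=> gL; have h : lipschitz_map (g : X -> R^o) by exists L.
  by exists (MkLip h).
have ex n : exists w' : lip X, lip_fun w' = (fun x => cutoff (drop n s) x * f x).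
  exact: lex (LM n).
have [w_ w_E] := choice ex.
have [z zE] := lex _ _ (lipschitz_cst 0).
(* Index 0 serves the core, index 1 the complement of the halo. *)
pose ww n := if n is n'.+1 then if n' is n''.+1 then w_ n'' else z else lipb_lip f.
pose l n := if n is n'.+1 then
  if n' is n''.+1 then 1 * Lip f + c * max_slope (drop n'' s) else 0 else Lip f.
pose g (y : borel X) := c * ring_slope s y + Lip f * \1_(halo s) y.
have g0 y : 0 <= g y.
  by rewrite addr_ge0// mulr_ge0 ?Lip_ge0// ring_slope_ge0.
have mh : measurable (halo s : set (borel X)) := measurable_halo s.
have mr := measurable_ring_slope s.
have mg : measurable_fun setT g.
  by apply: measurable_funD; apply: measurable_funM => //; exact: measurable_indic.
have [mS _] := current_mass cS.
rewrite TE -ST; apply: le_trans (local_bound (w := w) (w_ := ww) (l := l) cS mS pi _ mg g0 _) _.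
- case=> [|[|n]]; first exact: LipP.
    by rewrite /= zE; exact: lipschitz_cst.
  by rewrite /= w_E; exact: LM.
- move=> y; have [cy|ncy] := pselect (core s y).
    exists 0%N => /=; rewrite wE cutoff_core// mul1r; split => //.
    rewrite /g indicE mem_set; last exact: core_halo.
    by rewrite mulr1 lerDr mulr_ge0// ring_slope_ge0.
  have [hy|nhy] := pselect (halo s y); last first.
    by exists 1%N => /=; rewrite wE cutoff_out// mul0r zE g0.
  have [n [nE nle]] := cutoff_drop y s0.
  exists n.+2 => /=; rewrite wE w_E -nE; split => //.
  rewrite /g /ring_slope !indicE !mem_set// !mulr1 mul1r addrC lerD2r.
  by rewrite ler_wpM2l.
rewrite lee_wpmul2l ?lee_fin ?lip_prod_ge0//.
rewrite /g; under eq_integral do rewrite EFinD !EFinM.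
rewrite ge0_integralD//; last 4 first.
- by move=> y _; rewrite -EFinM lee_fin mulr_ge0// ring_slope_ge0.
- by apply: measurable_funeM; apply/measurable_EFinP.
- by move=> y _; rewrite -EFinM lee_fin mulr_ge0// Lip_ge0.
- by apply: measurable_funeM; apply/measurable_EFinP; exact: measurable_indic.
rewrite !ge0_integralZl_EFin ?Lip_ge0//; last 3 first.
- by apply/measurable_EFinP; exact: measurable_indic.
- by move=> y _; rewrite lee_fin ring_slope_ge0.
- exact/measurable_EFinP.
by rewrite integral_indic// setIT.
Qed.

End filling_estimate.

(** * Weights with divergent sum and small sum of powers *)

Section weights.
Context {R : realType}.

(** Cauchy condensation: the block from 2^j to 2^(j+1) sums to at most
2^j (2^j)^-p. *)
Lemma sum_dyadic_powR (p : R) (k : nat) : 1 < p ->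
  \sum_(0 <= i < 2 ^ k) i.+1%:R^-1 `^ p <= 1 + \sum_(0 <= j < k) (2 `^ (1 - p)) ^+ j.
Proof.
move=> p1; have p0 : 0 <= p by lra.
elim: k => [|k ih].
  by rewrite expn0 big_nat1 big_geq// invr1 powR1 addr0.
rewrite big_nat_recr//= (@big_cat_nat _ _ _ (2 ^ k)%N)//= ?leq_exp2l//.
rewrite addrA lerD//.
apply: (@le_trans _ _ (\sum_(2 ^ k <= i < 2 ^ k.+1) (2 ^ k)%:R^-1 `^ p)).
  rewrite big_nat [leRHS]big_nat; apply: ler_sum => i /andP[ki _].
  rewrite ge0_ler_powR ?nnegrE ?invr_ge0 ?ler0n// lef_pV2 ?posrE ?ltr0n ?expn_gt0//.
  by rewrite ler_nat ltnW.
rewrite big_const_nat iter_addr addr0 expnS mul2n -addnn addnK -[leLHS]mulr_natl.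
have k0 : 0 < (2 ^ k)%:R :> R by rewrite ltr0n expn_gt0.
rewrite -powR_mulrn ?powR_ge0// powRAC powR_mulrn// -natrX.
rewrite powR_invl// powRB; last by rewrite (gt_eqF k0) implybT.
by rewrite powRr1 ?(ltW k0).
Qed.

Lemma sum_harmonic_dyadic (k : nat) :
  k%:R / 2 <= \sum_(0 <= i < 2 ^ k) i.+1%:R^-1 :> R.
Proof.
elim: k => [|k ih]; first by rewrite mul0r sumr_ge0// => i _; rewrite invr_ge0.
rewrite (@big_cat_nat _ _ _ (2 ^ k)%N)//= ?leq_exp2l// -natr1 mulrDl lerD//.
apply: (@le_trans _ _ (\sum_(2 ^ k <= i < 2 ^ k.+1) (2 ^ k.+1)%:R^-1)); last first.
  rewrite [leLHS]big_nat [leRHS]big_nat; apply: ler_sum => i /andP[_ ik].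
  by rewrite lef_pV2 ?posrE ?ltr0n ?expn_gt0// ler_nat.
rewrite big_const_nat iter_addr addr0 expnS mul2n -addnn addnK addnn -mul2n natrM -[leRHS]mulr_natl.
rewrite le_eqVlt; apply/orP; left; apply/eqP; field.
by rewrite pnatr_eq0 -lt0n expn_gt0.
Qed.

(** Multiples of the harmonic sequence. *)
Lemma weights_exist (p e : R) : 1 < p -> 0 < e -> exists a : nat -> R,
  [/\ forall n, 0 < a n, forall N, \sum_(0 <= n < N) a n `^ p <= e &
      forall n0 (B : R), exists N, B <= \sum_(n0 <= n < N) a n].
Proof.
move=> p1 e0.
pose q : R := 2 `^ (1 - p).
have q0 : 0 < q by rewrite powR_gt0.
have q1 : q < 1.
  rewrite /q -opprB powRN invf_lt1 ?powR_gt0//.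
  have p10 : 0 < p - 1 by rewrite subr_gt0.
  have := @gt0_ltr_powR R _ p10 1 2; rewrite !nnegrE powR1.
  by apply; rewrite ?ler0n ?ltr1n.
pose W := 1 + (1 - q)^-1.
have W0 : 0 < W by rewrite addr_gt0// invr_gt0; lra.
pose r := (e / W) `^ p^-1.
have r0 : 0 < r by rewrite powR_gt0// divr_gt0.
have rp : r `^ p = e / W by rewrite /r -powRrM mulVf ?gt_eqF ?powRr1 ?divr_ge0 ?ltW//; lra.
exists (fun n => r * n.+1%:R^-1); split.
- by move=> n; rewrite mulr_gt0 // invr_gt0 ltr0n.
- move=> N; under eq_bigr do rewrite powRM ?(ltW r0) ?invr_ge0 ?ler0n//.
  rewrite -mulr_sumr rp -mulrA ler_piMr ?(ltW e0)// ler_pdivrMl// mulr1.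
  apply: (@le_trans _ _ (\sum_(0 <= n < 2 ^ N) n.+1%:R^-1 `^ p)).
    rewrite [leRHS](@big_cat_nat _ _ _ N)//= ?lerDl ?(ltnW (ltn_expl N _))//.
    by rewrite sumr_ge0// => n _; rewrite powR_ge0.
  rewrite (le_trans (sum_dyadic_powR N p1))// lerD2l.
  rewrite -[leRHS]mul1r ler_pdivlMr ?subr_gt0// mulrC big_mkord.
  have := subrX1 q N; rewrite -/q; set Sq := \sum_(i < N) _ => h.
  have qN : 0 <= q ^+ N by rewrite exprn_ge0// ltW.
  by move: h qN; lra.
- move=> n0 B.
  have B0 : 0 <= `|B| / r by rewrite divr_ge0// ltW.
  pose k := Num.trunc (2 * (`|B| / r + n0%:R)).
  exists (maxn n0 (2 ^ k.+1)); rewrite -mulr_sumr -ler_pdivrMl//.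
  apply: (@le_trans _ _ (`|B| / r)).
    by rewrite mulrC ler_wpM2r ?ler_norm// invr_ge0 ltW.
  have k1 : `|B| / r + n0%:R <= k.+1%:R / 2.
    by rewrite ler_pdivlMr// mulrC ltW// truncnS_gt.
  have := le_trans k1 (sum_harmonic_dyadic k.+1) => h.
  rewrite -(lerD2r n0%:R) (le_trans h)//.
  apply: (@le_trans _ _ (\sum_(0 <= i < maxn n0 (2 ^ k.+1)) i.+1%:R^-1)).
    rewrite [leRHS](@big_cat_nat _ _ _ (2 ^ k.+1)%N)//= ?leq_maxr// lerDl.
    by rewrite sumr_ge0// => i _; rewrite invr_ge0.
  rewrite (@big_cat_nat _ _ _ n0)//= ?leq_maxl// addrC lerD2l.
  apply: (@le_trans _ _ (\sum_(0 <= i < n0) 1)).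
    by apply: ler_sum => i _; rewrite invf_le1 ?ler1n ?ltr0n.
  by rewrite big_const_nat iter_addr addr0 subn0.
Qed.

End weights.

(** * Nested covers and null sets *)

Section nested_covers.
Context {R : realType} {X : pmetricType R}.
Variables (A : set X) (a : R).
Hypotheses (a0 : 0 <= a) (cA : compact A) (Afin : (hausdorff a A < +oo)%E).

Definition min_radius (s : seq (X * R)) : R := foldr (fun b v => Num.min b.2 v) 1 s.

Lemma min_radius_gt0 s : positive_radii s -> 0 < min_radius s.
Proof.
elim: s => //= b s ih /positive_radii_cons[b0 s0].
by rewrite lt_min b0 ih.
Qed.

Lemma min_radius_le s b : b \in s -> min_radius s <= b.2.
Proof.
elim: s => //= c s ih; rewrite inE => /orP[/eqP ->|/ih h]; rewrite ge_min ?lexx//.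
by rewrite h orbT.
Qed.

Lemma fine_cover_sort (s : seq (X * R)) d : fine_cover A s d ->
  fine_cover A (sort by_radius s) d.
Proof.
move=> [h1 h2]; split=> [b|x /h2[b bs bx]]; first by rewrite mem_sort => /h1.
by exists b => //; rewrite mem_sort.
Qed.

(** A point of the next halo is within three of the new radii of a point of A,
which is itself in a ball of the current cover; so it suffices that three times
the new radii be smaller than all the current ones. *)
Lemma nested_covers : exists (M : R) (s : nat -> seq (X * R)),
  [/\ forall n, fine_cover A (s n) n.+1%:R^-1,
      forall n, sorted by_radius (s n),
      forall n, \sum_(b <- s n) b.2 `^ a <= M &
      forall n, halo (s n.+1) `<=` core (s n)].
Proof.
have [M hM] := compact_ball_cover a0 cA Afin.
have ex d : exists s : seq (X * R), 0 < d ->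
    [/\ fine_cover A s d, sorted by_radius s & \sum_(b <- s) b.2 `^ a <= M].
  have [d0|d0] := ltP 0 d; last by exists [::].
  have [s sd sM] := hM d d0; exists (sort by_radius s) => _; split.
  - exact: fine_cover_sort.
  - by apply: sort_sorted => b c; exact: le_total.
  - by rewrite (perm_big _ (permEl (perm_sort _ _))).
have [cov covP] := choice ex.
(* The scales of the successive covers. *)
pose fix d (n : nat) : R := if n is n'.+1 then
  Num.min (min_radius (cov (d n')) / 3) n'.+2%:R^-1 else 1.
have pos s t : fine_cover A s t -> positive_radii s.
  by move=> [h _] b /h[_ /andP[]].
have d0 n : 0 < d n.
  elim: n => [|n ih] /=; first exact: ltr01.
  have [sc _ _] := covP _ ih.
  have m0 := min_radius_gt0 (pos _ _ sc).
  by rewrite lt_min divr_gt0// invr_gt0 ltr0n.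
have dn n : d n <= n.+1%:R^-1.
  by case: n => [|n] /=; [rewrite invr1|rewrite ge_min lexx orbT].
exists M, (fun n => cov (d n)); split.
- move=> n; have [[h1 h2] _ _] := covP _ (d0 n); split => // b /h1[? /andP[b0 bd]].
  by rewrite b0 (lt_le_trans bd).
- by move=> n; have [] := covP _ (d0 n).
- by move=> n; have [] := covP _ (d0 n).
- move=> n y [b bs by_]; have [[h1 _] _ _] := covP _ (d0 n.+1).
  have [Ab /andP[b0 bd]] := h1 b bs.
  have [[_ h2] _ _] := covP _ (d0 n).
  have [c cs cb] := h2 _ Ab; exists c => //.
  have mc := min_radius_le cs.
  have bm : 3 * b.2 < min_radius (cov (d n)).
    rewrite mulrC -ltr_pdivlMr//; apply: (lt_le_trans bd).
    by rewrite /= ge_min lexx.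
  rewrite (le_trans (metric_triangle _ b.1 _))//.
  rewrite [leRHS](_ : _ = c.2 + c.2); last by ring.
  by rewrite lerD ?(ltW cb)// (le_trans by_)// (le_trans (ltW bm)).
Qed.

End nested_covers.

Section compact_null.
Context {R : realType} {X : pmetricType R}.
Variables (A : set X) (p Q C : R).
Hypotheses (cA : compact A) (p0 : 0 < p) (pQ : p <= Q) (C0 : 0 < C).
Variable mu : {measure set (borel X) -> \bar R}.
Hypothesis muC : forall (x : X) r, 0 < r -> (mu (cball x r) <= (C * r `^ Q)%:E)%E.

Lemma measurable_compact : measurable (A : set (borel X)).
Proof.
by apply: measurable_closed; apply: compact_closed => //; exact: metric_hausdorff.
Qed.

(** Each ball has measure at most C r^Q <= C d^p r^(Q-p). *)
Lemma measure_le_cover (s : seq (X * R)) d M : fine_cover A s d ->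
  \sum_(b <- s) b.2 `^ (Q - p) <= M ->
  (mu A <= (C * d `^ p * M)%:E)%E.
Proof.
move=> [h1 h2] sM.
have mA := measurable_compact.
have mind b : measurable_fun setT (fun x : borel X => (\1_(cball b.1 b.2) x)%:E : \bar R).
  by apply/measurable_EFinP; apply: measurable_indic; exact: measurable_cball.
rewrite -[A in mu A]setIT -integral_indic//.
apply: (@le_trans _ _ (\int[mu]_x \sum_(b <- s) (\1_(cball b.1 b.2) x)%:E)%E).
  apply: ge0_le_integral => //.
  - by apply/measurable_EFinP; exact: measurable_indic.
  - exact: emeasurable_sum.
  move=> x _; rewrite sumEFin lee_fin indicE; case: (boolP (x \in A)) => [/set_mem Ax|_]; last first.
    by rewrite sumr_ge0.
  have [b bs bx] := h2 x Ax; rewrite (big_rem b)//= indicE mem_set/=; last exact: ltW.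
  by rewrite lerDl sumr_ge0.
rewrite ge0_integral_sum//.
apply: (@le_trans _ _ (\sum_(b <- s) (C * d `^ p * b.2 `^ (Q - p))%:E))%E; last first.
  by rewrite sumEFin lee_fin -mulr_sumr ler_wpM2l// mulr_ge0 ?powR_ge0// ltW.
rewrite big_seq [leRHS]big_seq; apply: lee_sum => b /h1[_ /andP[b0 bd]].
rewrite integral_indic ?setIT//; last exact: measurable_cball.
rewrite (le_trans (muC _ b0))// lee_fin -mulrA ler_wpM2l ?(ltW C0)//.
have -> : b.2 `^ Q = b.2 `^ p * b.2 `^ (Q - p).
  by rewrite -powRD; [rewrite addrC subrK|rewrite (gt_eqF b0) implybT].
by rewrite ler_wpM2r ?powR_ge0// ge0_ler_powR ?nnegrE ?(ltW p0)// ?(ltW b0)// ?(ltW bd)// (le_trans (ltW b0) (ltW bd)).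
Qed.

Lemma compact_null : (hausdorff (Q - p) A < +oo)%E -> mu A = 0%E.
Proof.
move=> Afin; have Qp : 0 <= Q - p by rewrite subr_ge0.
have [M hM] := compact_ball_cover Qp cA Afin.
apply/eqP; rewrite eq_le measure_ge0 andbT; apply/lee_addgt0Pr => e e0.
rewrite add0e.
have W0 : 0 < C * `|M| + 1 by rewrite ltr_wpDl// mulr_ge0// ltW.
pose d := (e / (C * `|M| + 1)) `^ p^-1.
have d0 : 0 < d by rewrite powR_gt0// divr_gt0.
have dp : d `^ p = e / (C * `|M| + 1).
  by rewrite /d -powRrM mulVf ?gt_eqF// powRr1// ltW// divr_gt0.
have [s sd sM] := hM d d0.
rewrite (le_trans (measure_le_cover sd sM))// lee_fin dp.
rewrite (@le_trans _ _ (C * (e / (C * `|M| + 1)) * `|M|))//.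
  by rewrite ler_wpM2l ?ler_norm// mulr_ge0 ?(ltW C0)// ltW// divr_gt0.
rewrite mulrAC mulrA ler_pdivrMr// mulrDr mulr1 [leLHS]mulrC lerDl ltW//.
Qed.

End compact_null.

(** * The test density *)

Section densities.
Context {R : realType} {X : pmetricType R}.

Lemma eseries_single (v : nat -> \bar R) n : (forall m, (0 <= v m)%E) ->
  (forall m, m != n -> v m = 0%E) -> (\sum_(m <oo) v m = v n)%E.
Proof.
move=> v0 vn; rewrite (@nneseriesD1 _ v n)// eseries0 ?adde0// => m _.
by move=> /andP[_ mn]; exact: vn.
Qed.

Variables (A : set X) (s : nat -> seq (X * R)) (a : nat -> R).
Hypothesis mA : measurable (A : set (borel X)).
Hypothesis s_pos : forall n, positive_radii (s n).
Hypothesis a_pos : forall n, 0 < a n.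
Hypothesis nested : forall n, halo (s n.+1) `<=` core (s n).

Lemma halo_core m n : (n < m)%N -> halo (s m) `<=` core (s n).
Proof.
elim: m => // m ih; rewrite ltnS leq_eqVlt => /orP[/eqP ->|nm]; first exact: nested.
by apply: (subset_trans _ (ih nm)) => x /nested; exact: core_halo.
Qed.

Lemma ring_slope_disjoint x m n :
  ring_slope (s m) x != 0 -> ring_slope (s n) x != 0 -> m = n.
Proof.
move=> /ring_slope_neq0[hm cm] /ring_slope_neq0[hn cn].
case: (ltngtP m n) => // mn; exfalso.
  exact/cm/(halo_core mn).
exact/cn/(halo_core mn).
Qed.

(** Infinite on A, where fillings may have positive mass, and charging all the
rings with the weights a_n elsewhere. *)
Definition blowup_density (x : borel X) : \bar R :=
  (\sum_(n <oo) (a n * ring_slope (s n) x)%:E + +oo * (\1_A x)%:E)%E.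

Let term_ge0 n x : (0 <= (a n * ring_slope (s n) x)%:E)%E.
Proof. by rewrite lee_fin mulr_ge0 ?ring_slope_ge0// ltW. Qed.

Let measurable_term n : measurable_fun setT (fun x : borel X => (a n * ring_slope (s n) x)%:E).
Proof.
by apply/measurable_EFinP; apply: measurable_funM => //; exact: measurable_ring_slope.
Qed.

Let measurable_indicA : measurable_fun setT (fun x : borel X => (\1_A x)%:E : \bar R).
Proof. by apply/measurable_EFinP; exact: measurable_indic. Qed.

Lemma blowup_density_ge0 x : (0 <= blowup_density x)%E.
Proof. by rewrite adde_ge0 ?nneseries_ge0// mule_ge0// lee_fin. Qed.

Lemma measurable_blowup_density : measurable_fun setT blowup_density.
Proof.
apply: emeasurable_funD; last exact: measurable_funeM.
exact: ge0_emeasurable_sum.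
Qed.

(** Off A at most one term of the series is nonzero, so the power of the sum is
the sum of the powers. *)
Lemma blowup_density_powR p x : 0 < p -> (blowup_density x `^ p <=
  \sum_(n <oo) (a n `^ p * ring_slope (s n) x `^ p)%:E + +oo * (\1_A x)%:E)%E.
Proof.
move=> p0; have v0 n : (0 <= (a n `^ p * ring_slope (s n) x `^ p)%:E)%E.
  by rewrite lee_fin mulr_ge0 ?powR_ge0.
rewrite /blowup_density indicE; case: (x \in A) => /=.
  rewrite mule1 [leRHS]addey; last by rewrite gt_eqF// (lt_le_trans ltNy0)// nneseries_ge0.
  by rewrite leey.
rewrite mule0 !adde0.
have [[n sn]|none] := pselect (exists n, ring_slope (s n) x != 0).
  have other m : m != n -> ring_slope (s m) x = 0.
    move=> mn; apply: contraNeq mn => sm.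
    by rewrite (ring_slope_disjoint sm sn).
  rewrite (@eseries_single _ n)//; last by move=> m /other ->; rewrite mulr0.
  rewrite (@eseries_single _ n)//; last first.
    by move=> m /other ->; rewrite powR0 ?gt_eqF// mulr0.
  by rewrite poweR_EFin powRM ?ring_slope_ge0// ltW.
have zero n : ring_slope (s n) x = 0.
  by apply: contrapT => /eqP sn; apply: none; exists n.
rewrite eseries0 ?poweR0r ?gt_eqF ?nneseries_ge0// => m _ _.
by rewrite zero mulr0.
Qed.

Lemma integral_blowup_density (mu : {measure set (borel X) -> \bar R}) (p M e : R) :
  0 < p -> mu A = 0%E -> 0 <= M ->
  (forall n, \int[mu]_x (ring_slope (s n) x `^ p)%:E <= M%:E)%E ->
  (forall N, \sum_(0 <= n < N) a n `^ p <= e) ->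
  (\int[mu]_x (blowup_density x `^ p) <= (M * e)%:E)%E.
Proof.
move=> p0 muA M0 sM ae.
have mpow n : measurable_fun setT (fun x : borel X => ring_slope (s n) x `^ p).
  apply: (measurableT_comp (measurable_powR p)); exact: measurable_ring_slope.
have v0 n x : (0 <= (a n `^ p * ring_slope (s n) x `^ p)%:E)%E.
  by rewrite lee_fin mulr_ge0 ?powR_ge0.
have mv n : measurable_fun setT (fun x : borel X => (a n `^ p * ring_slope (s n) x `^ p)%:E).
  by apply/measurable_EFinP; exact: measurable_funM.
have A0 : (\int[mu]_x (+oo * (\1_A x)%:E) = 0)%E.
  by rewrite ge0_integralZl//= integral_indic// setIT [X in (_ * X)%E]muA mule0.
apply: (@le_trans _ _ (\int[mu]_x
   (\sum_(n <oo) (a n `^ p * ring_slope (s n) x `^ p)%:E + +oo * (\1_A x)%:E))%E).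
  apply: ge0_le_integral => //.
  - by move=> x _; exact: poweR_ge0.
  - apply: (measurableT_comp (measurable_poweR p)); exact: measurable_blowup_density.
  - by apply: emeasurable_funD; [exact: ge0_emeasurable_sum|exact: measurable_funeM].
  - by move=> x _; exact: blowup_density_powR.
have mS : measurable_fun setT (fun x : borel X =>
    \sum_(n <oo) (a n `^ p * ring_slope (s n) x `^ p)%:E)%E.
  exact: ge0_emeasurable_sum.
have mI : measurable_fun setT (fun x : borel X => +oo * (\1_A x)%:E : \bar R)%E.
  exact: measurable_funeM.
have S0 x : (0 <= \sum_(n <oo) (a n `^ p * ring_slope (s n) x `^ p)%:E)%E.
  exact: nneseries_ge0.
have I0 x : (0 <= +oo * (\1_A x)%:E :> \bar R)%E by rewrite mule_ge0// lee_fin.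
rewrite ge0_integralD//.
rewrite [X in (_ + X)%E]A0 adde0 integral_nneseries//.
apply: lime_le; first by apply: is_cvg_nneseries => n _ _; exact: integral_ge0.
apply: nearW => N; apply: (@le_trans _ _ (\sum_(0 <= n < N) (a n `^ p * M)%:E)%E).
  apply: lee_sum => n _; under eq_integral do rewrite EFinM.
  rewrite ge0_integralZl_EFin ?powR_ge0//; last 2 first.
  - by move=> x _; rewrite lee_fin powR_ge0.
  - exact/measurable_EFinP.
  by rewrite EFinM lee_wpmul2l ?lee_fin ?powR_ge0.
by rewrite sumEFin lee_fin -mulr_suml mulrC ler_wpM2l.
Qed.

Lemma blowup_density_infinite (nu : {measure set (borel X) -> \bar R}) :
  (forall n0 (B : R), exists N, B <= \sum_(n0 <= n < N) a n) ->
  (nu A = 0%E -> exists g n0, 0 < g /\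
     forall n, (n0 <= n)%N -> (g%:E <= \int[nu]_x (ring_slope (s n) x)%:E)%E) ->
  (1 <= \int[nu]_x blowup_density x)%E.
Proof.
move=> a_div low.
have [nuA|nuA] := eqVneq (nu A) 0%E; last first.
  apply: (@le_trans _ _ (\int[nu]_x (+oo * (\1_A x)%:E))%E).
    rewrite ge0_integralZl//= integral_indic// setIT gt0_mulye ?leey//.
    by rewrite lt_neqAle eq_sym nuA measure_ge0.
  apply: ge0_le_integral => //.
  - exact: measurable_funeM.
  - exact: measurable_blowup_density.
  - by move=> x _; rewrite leeDr// nneseries_ge0.
have [g [n0 [g0 gle]]] := low nuA.
have [N hN] := a_div n0 g^-1.
apply: (@le_trans _ _ (\int[nu]_x \sum_(n0 <= n < N) (a n * ring_slope (s n) x)%:E)%E); last first.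
  apply: ge0_le_integral => //.
  - by move=> x _; exact: sume_ge0.
  - exact: emeasurable_sum.
  - exact: measurable_blowup_density.
  move=> x _; rewrite /blowup_density.
  apply: (@le_trans _ _ (\sum_(n <oo) (a n * ring_slope (s n) x)%:E)%E).
    apply: le_trans (nneseries_lim_ge N _) => //.
    have [n0N|Nn0] := leqP n0 N; last by rewrite big_geq ?sume_ge0// ltnW.
    by rewrite [leRHS](@big_cat_nat _ _ _ n0)//= leeDr ?sume_ge0.
  by rewrite leeDl// mule_ge0// lee_fin.
rewrite ge0_integral_sum//.
apply: (@le_trans _ _ (\sum_(n0 <= n < N) (a n * g)%:E)%E).
  rewrite sumEFin lee_fin -mulr_suml -ler_pdivrMr// mul1r.
  exact: hN.
rewrite big_nat [leRHS]big_nat; apply: lee_sum => n /andP[n0n _].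
under eq_integral do rewrite EFinM.
rewrite ge0_integralZl_EFin ?(ltW (a_pos n))//; last 2 first.
- by move=> x _; rewrite lee_fin ring_slope_ge0.
- by apply/measurable_EFinP; exact: measurable_ring_slope.
by rewrite EFinM lee_wpmul2l ?gle// lee_fin ltW.
Qed.

End densities.

(** * The capacity estimate *)

Section lower_bound.
Context {R : realType} {X : pmetricType R} {m : nat}.
Variables (A : set X) (s : nat -> seq (X * R)).
Hypothesis mA : measurable (A : set (borel X)).
Hypothesis cA : closed A.
Hypothesis s_cover : forall n, fine_cover A (s n) n.+1%:R^-1.
Hypothesis s_sorted : forall n, sorted by_radius (s n).
Hypothesis nested : forall n, halo (s n.+1) `<=` core (s n).

Lemma fine_cover_pos n : positive_radii (s n).
Proof. by move=> b /((s_cover n).1)[_ /andP[]]. Qed.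

Lemma cover_core n : A `<=` core (s n).
Proof.
move=> x /((s_cover n).2)[b bs bx]; exists b => //.
have b0 := fine_cover_pos bs.
by rewrite (le_trans (ltW bx))// ler_peMl ?(ltW b0)// ler1n.
Qed.

Lemma halo_nonincreasing : {homo (fun n => halo (s n)) : k n / (k <= n)%N >-> n `<=` k}.
Proof.
move=> k n; rewrite leq_eqVlt => /orP[/eqP ->//|kn].
apply: subset_trans (halo_core fine_cover_pos nested kn) _.
exact/core_halo/fine_cover_pos.
Qed.

Lemma bigcap_halo : \bigcap_n halo (s n) `<=` A.
Proof.
move=> y hy; apply: cA => U /nbhs_ballP[e /= e0 eU].
have [n ne] : exists n : nat, 3 * n.+1%:R^-1 < e.
  exists (Num.trunc (3 / e)); rewrite ltr_pdivrMr ?ltr0n// mulrC -ltr_pdivrMr//.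
  exact: truncnS_gt.
have [b bs yb] := hy n I.
have [Ab /andP[b0 bn]] := (s_cover n).1 b bs.
exists b.1; split => //; apply: eU; rewrite ballEmdist /= metric_sym.
by rewrite (le_lt_trans yb)// (le_lt_trans _ ne)// ler_wpM2l// ltW.
Qed.

Lemma measure_halo_small (nu : {measure set (borel X) -> \bar R}) (e : R) :
  (nu setT < +oo)%E -> nu A = 0%E -> 0 < e ->
  exists n0, forall n, (n0 <= n)%N -> (nu (halo (s n)) <= e%:E)%E.
Proof.
move=> nuT nuA e0.
have mH n : measurable (halo (s n) : set (borel X)) := measurable_halo (s n).
have [|||n0 hn0] := @measure_small _ _ nu nuT
    (fun n => (halo (s n) : set (borel X)) `\` A) e _ _ _ e0.
- by move=> n; exact: measurableD.
- by move=> k n kn; apply: setSD; exact: halo_nonincreasing.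
- rewrite -subset0 => x hx; have [_ nAx] := hx 0%N I.
  by apply/nAx/bigcap_halo => n _; have [] := hx n I.
exists n0 => n n0n.
have hA : halo (s n) `<=` (halo (s n0) `\` A) `|` A.
  move=> x /(halo_nonincreasing n0n) hx.
  by have [?|?] := pselect (A x); [right|left].
rewrite (@le_trans _ _ (nu ((halo (s n0) `\` A) `|` A)))//.
  by rewrite le_measure ?inE//; apply: measurableU => //; exact: measurableD.
rewrite (le_trans (measureU2 _ _ _))//; first exact: measurableD.
by rewrite [X in (_ + X)%E]nuA adde0.
Qed.

(** In [filling_estimate] the term carrying ||S||(halo) is eventually at most half
of |T(f, pi)|, and the slope term has to account for the other half. *)
Lemma filling_slope_lower_bound (S : functional X m.+1) (T : functional X m) :
  is_current S -> integral_current T -> boundary S = T ->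
  spt T `<=` A -> T <> (fun _ _ => 0) -> mass S A = 0%E ->
  exists g n0, 0 < g /\ forall n, (n0 <= n)%N ->
    (g%:E <= \int[mass S]_x (ring_slope (s n) x)%:E)%E.
Proof.
move=> cS iT ST TA Tn0 SA.
have cT := integral_is_current iT.
have [f [pi Tf0]] : exists f pi, T f pi != 0.
  apply: contrapT => none; apply: Tn0; apply/funext => f; apply/funext => pi.
  by apply: contrapT => /eqP Tf; apply: none; exists f, pi.
have t0 : 0 < `|T f pi| by rewrite normr_gt0.
set t := `|T f pi| in t0.
have [c fc] := lipb_prop f.
have c0 : 0 <= c := le_trans (normr_ge0 _) (fc point).
pose P := lip_prod pi; have P0 : 0 <= P := lip_prod_ge0 pi.
pose L := Lip f; have L0 : 0 <= L := Lip_ge0 f.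
have PL : 0 < 2 * (P * L + 1) by rewrite mulr_gt0// ltr_wpDl// mulr_ge0.
have Pc : 0 < 2 * (P * c + 1) by rewrite mulr_gt0// ltr_wpDl// mulr_ge0.
have [ST_fin _] := (current_mass cS).1.
have [n0 hn0] := measure_halo_small ST_fin SA (divr_gt0 t0 PL).
exists (t / (2 * (P * c + 1))), n0; split; first exact: divr_gt0.
move=> n n0n; rewrite leNgt; apply/negP => lt_g.
have Tcore : mass T (~` core (s n) : set (borel X)) = 0%E.
  apply: (mass_outside_spt (integral_concentrated iT) TA).
    by apply: measurableC; exact: measurable_core.
  by apply: subsetC; exact: cover_core.
have := filling_estimate cS cT ST pi (@fine_cover_pos n) (s_sorted n) Tcore fc.
apply/negP; rewrite -ltNge -/t -/P -/L.
have bound : P * (c * (t / (2 * (P * c + 1))) + L * (t / (2 * (P * L + 1)))) < t.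
  rewrite mulrDr [ltRHS](splitr t) !mulrA; apply: ltrD.
    rewrite ltr_pdivrMr// (_ : t / 2 * (2 * (P * c + 1)) = P * c * t + t); last by field.
    by rewrite ltrDl.
  rewrite ltr_pdivrMr// (_ : t / 2 * (2 * (P * L + 1)) = P * L * t + t); last by field.
  by rewrite ltrDl.
apply: (@le_lt_trans _ _ (P * (c * (t / (2 * (P * c + 1))) + L * (t / (2 * (P * L + 1)))))%:E); last first.
  by rewrite lte_fin.
rewrite EFinM lee_wpmul2l ?lee_fin// EFinD !EFinM -/L leeD//.
  by rewrite -EFinM lee_wpmul2l ?lee_fin// ltW.
by rewrite -EFinM lee_wpmul2l ?lee_fin// hn0.
Qed.

End lower_bound.

Theorem theorem3p13 (R : realType) (X : completeMetricType R)
    (mu : {measure set (borel X) -> \bar R}) (p Q : R) (m : nat) (C : R)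
    (p_gt1 : 1 < p) (p_le_Q : p <= Q) (C_gt0 : 0 < C)
    (mu_ball : forall (x : X) (r : R), 0 < r ->
       (mu (cball x r) <= (C * r `^ Q)%:E)%E)
    (A : set X) (A_compact : compact A) (A_fin : (hausdorff (Q - p) A < +oo)%E)
    (Lambda : set (functional X m))
    (Lambda_cycles : forall T, Lambda T -> integral_cycle T)
    (Lambda_spt : forall T, Lambda T -> spt T `<=` A)
    (Lambda_neq0 : forall T, Lambda T -> T <> (fun _ _ => 0)) :
  capacity p mu Lambda [set S | integral_current S] = 0%E.
Proof.
have p0 : 0 < p by lra.
have Qp : 0 <= Q - p by rewrite subr_ge0.
have mA := measurable_compact A_compact.
have cA : closed A by apply: compact_closed => //; exact: metric_hausdorff.
have muA := compact_null A_compact p0 p_le_Q C_gt0 mu_ball A_fin.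
have [M [s [s_cover s_sorted sM nested]]] := nested_covers Qp A_compact A_fin.
have s_pos := fine_cover_pos s_cover.
apply/eqP; rewrite eq_le; apply/andP; split; last first.
  apply: le_ereal_inf_tmp => _ [f _ <-]; apply: integral_ge0 => x _.
  exact: poweR_ge0.
apply/lee_addgt0Pr => e e0; rewrite add0e.
pose K := C * 3 `^ Q * M.
have K0 : 0 <= K.
  rewrite !mulr_ge0 ?powR_ge0 ?(ltW C_gt0)//.
  by apply: le_trans (sM 0%N); rewrite sumr_ge0// => b _; exact: powR_ge0.
have K1 : 0 < K + 1 by rewrite ltr_wpDl.
have [a [a0 a_sum a_div]] := weights_exist p_gt1 (divr_gt0 e0 K1).
apply: (@le_trans _ _ (\int[mu]_x (blowup_density A s a x `^ p))%E).
  apply: ereal_inf_lbound; exists (blowup_density A s a) => //; split.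
  - exact: measurable_blowup_density.
  - exact: blowup_density_ge0.
  move=> S [iS [T LT ST]].
  apply: (blowup_density_infinite mA s_pos a0 a_div).
  have [iT _] := Lambda_cycles T LT.
  exact: (filling_slope_lower_bound mA cA s_cover s_sorted nested
    (integral_is_current iS) iT ST (Lambda_spt T LT) (Lambda_neq0 T LT)).
rewrite (le_trans (integral_blowup_density mA s_pos a0 nested p0 muA K0 _ a_sum))//.
  move=> n; exact: (integral_ring_slope p0 (ltW C_gt0) (s_pos n) mu_ball (sM n)).
by rewrite lee_fin mulrA ler_pdivrMr// mulrDr mulr1 mulrC lerDl ltW.
Qed.
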